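(* Let $c,d\in[0,1)$ with $d>0$, and let $\mathbf q=(q_k)_{k\in\mathbb N}\in\mathcal Q^+$ be given by $$q_k=\frac{c^{k-1}d(1-c)^2}{(1-c^kd)^2}.$$ Then for every $k\in\mathbb N$, $\bar{\mathcal W}_k(\mathbf q):=\int_{\Omega_*}d\phi_{\mathbf q}(\eta)\,\mathcal W_k(\eta,0)$ satisfies $$\bar{\mathcal W}_k(\mathbf q)=\frac12-\frac{1+c^kd}{2(1-c^kd)}+\frac{c^{k-1}d(1-c)}{(1-c^{k-1}d)(1-c^kd)}\left(k-1+\frac{(1+c)(1-d)}{(1-c)(1+d)}\right).$$ In particular, $J_k(\mathbf q):=\bar{\mathcal W}_k(\mathbf q)-\bar{\mathcal W}_{k+1}(\mathbf q)$ equals $$\frac{kc^{k-1}d(1-c)^2(1+c^kd)}{(1-c^{k-1}d)(1-c^kd)(1-c^{k+1}d)}-\frac{2c^{k-1}d^2(1-c)(1+c)(1-c^k)}{(1-c^{k-1}d)(1-c^kd)(1-c^{k+1}d)(1+d)}.$$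
   Context: $\mathbb N=\{1,2,\dots\}$, $0^0=1$. **Configurations.** $\Omega=\{\eta\in\{0,1\}^{\mathbb Z}:\lim_{x\to\infty}\frac1x\sum_{y=-x}^{0}\eta(y)<\frac12\}$. A site $x$ is a record of $\eta$ if $\sum_{y=z}^{x}(2\eta(y)-1)<0$ for all $z\le x$. $(s_\infty(\eta,i))_{i\in\mathbb Z}$ enumerates the records increasingly, $s_\infty(\eta,0)$ being the largest record $\le0$ ($s_\infty(\eta,i)=\infty$ if there are too few records on the right). $\Omega_*=\{\eta\in\Omega:|s_\infty(\eta,i)|<\infty\ \forall i\}$, $\Omega_r=\{\eta\in\Omega_*:s_\infty(\eta,0)=0\}$. **Seat numbers.** For $\eta$ with records unbounded below, $(\mathcal W_k(\eta,\cdot))_{k\in\mathbb N}$, $\mathcal W_k(\eta,\cdot):\mathbb Z\to\{0,1\}$, are the unique functions vanishing at every record and satisfying $\mathcal W_k(\eta,x)=\mathcal W_k(\eta,x-1)+\eta^{\uparrow}_k(x)-\eta^{\downarrow}_k(x)$ for all $x\in\mathbb Z$, where $\eta^{\uparrow}_k(x)=\eta(x)(1-\mathcal W_k(\eta,x-1))\prod_{j=1}^{k-1}\mathcal W_j(\eta,x-1)$ and $\eta^{\downarrow}_k(x)=(1-\eta(x))\mathcal W_k(\eta,x-1)\prod_{j=1}^{k-1}(1-\mathcal W_j(\eta,x-1))$. Define $\xi_k(\eta,\cdot)$ by $\xi_k(\eta,s_\infty(\eta,0))=0$ and $\xi_k(\eta,x)-\xi_k(\eta,x-1)=1-\sum_{j=1}^{k}(\eta^\uparrow_j(x)+\eta^\downarrow_j(x))$;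 $s_k(\eta,x)=\min\{y\in\mathbb Z:\xi_k(\eta,y)=x\}$; $\zeta_k(\eta,i)=\sum_{y=s_k(\eta,i)+1}^{s_k(\eta,i+1)}(\eta^{\uparrow}_k(y)-\eta^{\uparrow}_{k+1}(y))$. **Excursions.** An excursion of length $2n+1$, $n\in\mathbb Z_{\ge0}$, is $\varepsilon=(\varepsilon_0,\dots,\varepsilon_{2n})\in\{0,1\}^{2n+1}$ with $\varepsilon_0=0$, $\sum_{j=1}^{m}(2\varepsilon_j-1)\ge0$ for $1\le m<2n$, and $\sum_{j=1}^{2n}(2\varepsilon_j-1)=0$. $\mathcal E$ is the set of all excursions, $|\varepsilon|$ the length. $\iota(\varepsilon)\in\{0,1\}^{\mathbb Z}$ equals $\varepsilon_x$ for $0\le x\le|\varepsilon|-1$ and $0$ elsewhere. $\zeta_k(\varepsilon)=\sum_{i=0}^{\xi_k(\iota(\varepsilon),|\varepsilon|)-1}\zeta_k(\iota(\varepsilon),i)$. **Measures.** $\mathcal Q^+=\{\mathbf q\in[0,1)^{\mathbb N}:\sum_k kq_k<\infty\}$. For $\mathbf q\in\mathcal Q^+$, $\varphi_{\mathbf q}(\varepsilon)=\prod_{k\in\mathbb N}q_k^{\zeta_k(\varepsilon)}(1-q_k)^{1+2\sum_{\ell\in\mathbb N}\ell\zeta_{k+\ell}(\varepsilon)}$ is a probability measure on $\mathcal E$, and $\bar\varepsilon(\mathbf q)=\sum_\varepsilon|\varepsilon|\varphi_{\mathbf q}(\varepsilon)<\infty$. $\hat\phi_{\mathbf q}$ is the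 law (on $\Omega_r$) of the concatenation $\cdots\varepsilon_{-1}\varepsilon_0\varepsilon_1\cdots$, first letter of $\varepsilon_0$ at site $0$, of i.i.d. excursions with law $\varphi_{\mathbf q}$. With $(\tau_y\eta)(x)=\eta(x+y)$, $\phi_{\mathbf q}$ is the probability measure on $\Omega_*$ with $\int f\,d\phi_{\mathbf q}=\frac1{\bar\varepsilon(\mathbf q)}\int d\hat\phi_{\mathbf q}(\eta)\sum_{y=0}^{s_\infty(\eta,1)-1}f(\tau_y\eta)$. *)

(* Defs.v *)
From HB Require Import structures.
From mathcomp Require Import all_boot all_order all_algebra.
From mathcomp Require Import all_classical all_reals all_analysis.
From mathcomp Require Import measurable_realfun.
Set Implicit Arguments.
Unset Strict Implicit.
Unset Printing Implicit Defensive.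
Import Order.TTheory GRing.Theory Num.Theory.
Import numFieldNormedType.Exports.
Local Open Scope classical_set_scope.
Local Open Scope ring_scope.

(* Families indexed by N = {1, 2, ...} are written as functions of k : nat, and
   only their values at k > 0 are meaningful. Occupation variables are booleans,
   cast to numbers by b%:R. *)

(** * Configurations and records *)

Definition is_record (eta : int -> bool) (x : int) : Prop :=
  forall z : int, z <= x -> \sum_(y \in `[z, x]) (2 * (eta y)%:R - 1 : int) < 0.

(* The value +oo of s i means that there are too few records on the right;
   -oo cannot occur. *)
Definition is_record_enum (eta : int -> bool) (s : int -> \bar int) : Prop :=
  [/\ forall i j : int, i < j -> (s i < s j)%E \/ (s i = +oo%E /\ s j = +oo%E),
      forall x : int, is_record eta x <-> exists i : int, s i = x%:E
    & exists x0 : int, [/\ s 0 = x0%:E, x0 <= 0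
        & forall x : int, is_record eta x -> x <= 0 -> x <= x0]].

(* s_oo: the unique enumeration when the records are unbounded below. *)
Definition s_inf (eta : int -> bool) : int -> \bar int :=
  xget (fun=> +oo%E) [set s | is_record_enum eta s].

Definition Omega (R : realType) : set (int -> bool) :=
  [set eta | exists2 l : R,
    (fun n : nat => n%:R^-1 * \sum_(0 <= y < n.+1) (eta (- y%:Z))%:R : R) @ \oo
      --> l & l < 1 / 2].

Definition Omega_star (R : realType) : set (int -> bool) :=
  [set eta | Omega R eta /\ forall i : int, s_inf eta i \is a fin_num].

Definition Omega_r (R : realType) : set (int -> bool) :=
  [set eta | Omega_star R eta /\ s_inf eta 0 = 0%:E].

(** * Seat numbers *)

Definition up (eta : int -> bool) (W : nat -> int -> bool) (k : nat) (x : int)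
    : int :=
  (eta x)%:R * (1 - (W k (x - 1))%:R) * \prod_(1 <= j < k) (W j (x - 1))%:R.

Definition down (eta : int -> bool) (W : nat -> int -> bool) (k : nat) (x : int)
    : int :=
  (1 - (eta x)%:R) * (W k (x - 1))%:R * \prod_(1 <= j < k) (1 - (W j (x - 1))%:R).

Definition is_seat (eta : int -> bool) (W : nat -> int -> bool) : Prop :=
  forall k : nat, (0 < k)%N ->
    (forall x : int, is_record eta x -> W k x = false) /\
    (forall x : int,
      (W k x)%:R = (W k (x - 1))%:R + up eta W k x - down eta W k x :> int).

(* Such a W is unique (at k > 0) when the records of eta are unbounded below. *)
Definition seat (eta : int -> bool) : nat -> int -> bool :=
  get [set W | is_seat eta W].

Definition eta_up (eta : int -> bool) := up eta (seat eta).
Definition eta_down (eta : int -> bool) := down eta (seat eta).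

Definition xi (k : nat) (eta : int -> bool) : int -> int :=
  xget (fun=> 0) [set f | f (fine (s_inf eta 0)) = 0 /\
    forall x : int, f x - f (x - 1) =
      1 - \sum_(1 <= j < k.+1) (eta_up eta j x + eta_down eta j x)].

Definition s_ (k : nat) (eta : int -> bool) (x : int) : int :=
  xget 0 [set y | xi k eta y = x /\ forall z : int, xi k eta z = x -> y <= z].

Definition zeta (k : nat) (eta : int -> bool) (i : int) : int :=
  \sum_(y \in `]s_ k eta i, s_ k eta (i + 1)])
    (eta_up eta k y - eta_up eta k.+1 y).

(** * Excursions *)

Definition walk (s : seq bool) (m : nat) : int :=
  \sum_(1 <= j < m.+1) (2 * (nth false s j)%:R - 1).

(* With size s = 2n + 1, the number 2n is (size s).-1. *)
Definition is_excursion (s : seq bool) : bool :=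
  [&& odd (size s), nth false s 0 == false,
      all (fun m => 0 <= walk s m) (index_iota 1 (size s).-1)
    & walk s (size s).-1 == 0].

Notation excursion := {s : seq bool | is_excursion s}.

Definition len (e : excursion) : nat := size (val e).

Definition iota_exc (e : excursion) : int -> bool :=
  fun x => if x is Posz n then nth false (val e) n else false.

Definition zeta_exc (k : nat) (e : excursion) : int :=
  \sum_(i \in `[0, xi k (iota_exc e) (len e)%:Z[) zeta k (iota_exc e) i.

(** * Measures *)

Definition Qplus (R : realType) (q : nat -> R) : Prop :=
  (forall k : nat, (0 < k)%N -> 0 <= q k < 1) /\
  cvgn (series (fun k : nat => k%:R * q k)).

(* The sum over l has finite support; q ^ 0 = 1 also for q = 0. *)
Definition varphi (R : realType) (q : nat -> R) (e : excursion) : R :=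
  limn (fun n : nat => \prod_(1 <= k < n.+1)
    (q k ^ zeta_exc k e *
     (1 - q k) ^
       (1 + 2 * \sum_(l \in [set l | (0 < l)%N]) (l%:Z * zeta_exc (k + l) e)))).

Definition mean_len (R : realType) (q : nat -> R) : \bar R :=
  \esum_(e in [set: excursion]) ((len e)%:R * varphi q e)%:E.

Definition cylinders : set (set (int -> bool)) :=
  [set A | exists (x : int) (b : bool), A = [set eta | eta x = b]].

(* {0,1}^Z with the product sigma-algebra. *)
Notation config := (g_sigma_algebraType cylinders).

(* e i, i : int, are independent, each with law varphi q. *)
Definition iid_excursions (R : realType) (q : nat -> R) (d : measure_display)
    (T : measurableType d) (P : probability T R) (e : int -> T -> excursion)
    : Prop :=
  [/\ forall (i : int) (A : set excursion), measurable (e i @^-1` A),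
      forall (i : int) (a : excursion),
        P (e i @^-1` [set a]) = (varphi q a)%:E
    & forall (J : seq int) (A : int -> set excursion), uniq J ->
        P (\bigcap_(i in [set` J]) (e i @^-1` A i)) =
        (\prod_(i <- J) P (e i @^-1` A i))%E].

(* First site of the i-th excursion when the 0-th one starts at site 0. *)
Definition start (e : int -> excursion) (i : int) : int :=
  \sum_(j \in `[0, i[) (len (e j))%:Z - \sum_(j \in `[i, 0[) (len (e j))%:Z.

Definition concat (e : int -> excursion) : int -> bool :=
  get [set eta : int -> bool | forall (i : int) (m : nat), (m < len (e i))%N ->
    eta (start e i + m%:Z) = nth false (val (e i)) m].

(* nu is hat phi_q; the law is carried by Omega_r. *)
Definition is_phihat (R : realType) (q : nat -> R) (nu : probability config R)
    : Prop :=
  nu (Omega_r R) = 1%E /\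
  exists (d : measure_display) (T : measurableType d) (P : probability T R)
         (e : int -> T -> excursion),
    iid_excursions q P e /\
    forall A : set config, measurable A ->
      nu A = P [set w | A (concat (fun i => e i w))].

Definition shift (y : int) (eta : int -> bool) : int -> bool :=
  fun x => eta (x + y).

(* mu is phi_q, obtained from nu = hat phi_q. *)
Definition is_phi (R : realType) (q : nat -> R) (nu mu : probability config R)
    : Prop :=
  mu (Omega_star R) = 1%E /\
  forall f : config -> \bar R, measurable_fun [set: config] f ->
    (forall eta, (0 <= f eta)%E) ->
    (\int[mu]_(eta in Omega_star R) f eta =
     ((fine (mean_len q))^-1)%:E *
     \int[nu]_(eta in Omega_r R)
       \sum_(y \in `[0%R, fine (s_inf eta 1)[) f (shift y eta))%E.

Definition Wbar (R : realType) (mu : probability config R) (k : nat) : \bar R :=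
  (\int[mu]_(eta in Omega_star R) ((seat eta k 0)%:R : R)%:E)%E.

Definition J_ (R : realType) (mu : probability config R) (k : nat) : \bar R :=
  (Wbar mu k - Wbar mu k.+1)%E.

(* Main.v *)
Require Import Defs.
From mathcomp Require Import all_boot all_order all_algebra.
From mathcomp Require Import all_classical all_reals all_analysis.
From mathcomp Require Import measurable_realfun.
From mathcomp Require Import ring lra zify.

(* W_1 = eta, and a letter moves seat 1 exactly when it differs from the letter
   before it. Erasing these letters (the first letter of each run) sends an
   excursion to an excursion, shifts all seat numbers down by one, and turns
   zeta_k into zeta_{k-1}; conversely an excursion is recovered by inserting, after
   each surviving letter, an alternating word, and under varphi q the numbers of
   inserted pairs are independent geometric variables of parameter q_1. Hence, for
   the number of sites occupied by a seat and the number of those followed by a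
   different letter, the means under q and under the shifted weights are related
   by the linear map (a, b) |-> (a + b + 2 m a, b + 2 m a), m = q_1 / (1 - q_1).
   The length obeys the same recursion with different initial values, so the mean
   number of sites occupied by seat k is half the mean length minus half the
   mean length for the weights (q_1, ..., q_{k-1}, 0, 0, ...). For the weights of
   the theorem shifting q amounts to replacing d by c d, and 1 - q_k =
   (1 - c^(k-1) d) (1 - c^(k+1) d) / (1 - c^k d)^2 telescopes, so that both are
   explicit. *)

Set Implicit Arguments.
Unset Strict Implicit.
Unset Printing Implicit Defensive.
Import Order.TTheory GRing.Theory Num.Theory.
Import numFieldNormedType.Exports.
Local Open Scope classical_set_scope.
Local Open Scope ring_scope.

(** * Seats of finite words *)

(** The linear map closes on the pair (sites, turns) for the following reason. Between surviving
    letters a and b stand 2n letters, plus one more if a and b differ, and the upper seats do not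
    move there. The new sites thus repeat the value of the observable at a, twice per pair and once
    more if a is a turn of the reduced word. Such a gap also creates exactly as many turns as it has
    letters, since these alternate and the last one equals b. Two obstacles shape the rest.
    [varphi q] is an infinite product over words of unbounded complexity, so sums are computed on
    words that vanish after K reductions, where induction on K applies; the factors beyond K
    contribute the product of the [1 - q k] for k > K, which tends to 1. Moreover [seat] is picked
    by choice and not visibly measurable, so it is replaced by a function of the finite words that
    start just after a record, where all seats are empty. The definition of phi then turns the
    density at site 0 into the mean number of occupied sites of an excursion over its mean
    length. *)

(* The seat rule in closed form: a letter b fills (b = 1) or empties (b = 0)
   the first seat whose content is not b. Index k stands for seat k + 1. *)
Definition step (b : bool) (w : nat -> bool) (k : nat) : bool :=
  if all (fun j => w j == b) (iota 0 k) then b else w k.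

Definition run (w : nat -> bool) (s : seq bool) : nat -> bool :=
  foldl (fun w b => step b w) w s.

Definition empty : nat -> bool := fun=> false.

Definition upper (w : nat -> bool) : nat -> bool := fun j => w j.+1.

Lemma step0 b w : step b w 0 = b. Proof. by []. Qed.

Lemma upper_empty : upper empty = empty. Proof. by []. Qed.

(** A letter that moves seat 1 leaves the other seats alone; any other letter acts on them by the
    same rule. So the upper seats form a seat process driven by fewer letters. *)
Lemma upper_step b w :
  upper (step b w) = if w 0%N == b then step b (upper w) else upper w.
Proof.
apply/funext => k; rewrite /upper /step /=; case: eqP => //= _.
by rewrite -[1%N]addn0 iotaDl all_map.
Qed.

Lemma step_false_empty : step false empty = empty.
Proof. by apply/funext => k; rewrite /step; case: ifP. Qed.

Lemma run_cat w s t : run w (s ++ t) = run (run w s) t.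
Proof. exact: foldl_cat. Qed.

(* Erases the first letter of every run, p being the letter before the word.
   The erased letters are exactly those that move seat 1. *)
Fixpoint red (p : bool) (s : seq bool) : seq bool :=
  if s is b :: s' then if b == p then b :: red b s' else red b s' else [::].

Lemma upper_run w s : upper (run w s) = run (upper w) (red (w 0%N) s).
Proof.
elim: s w => [//|b s IH] w /=; rewrite IH upper_step step0 eq_sym.
by case: eqP.
Qed.

Lemma run0 w s : run w s 0%N = last (w 0%N) s.
Proof. by elim: s w => [//|b s IH] w /=; rewrite IH step0. Qed.

Lemma size_red p s : (size (red p s) <= size s)%N.
Proof.
elim: s p => [//|b s IH] p /=; case: ifP => _ /=; first exact: IH.
exact: leq_trans (IH b) (leqnSn _).
Qed.

Lemma red_cat p s t : red p (s ++ t) = red p s ++ red (last p s) t.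
Proof. by elim: s p => [//|b s IH] p /=; rewrite IH; case: ifP. Qed.

(** * Height and Dyck words *)

Definition hgt (s : seq bool) : int := \sum_(b <- s) (2 * b%:R - 1).

Lemma hgt_nil : hgt [::] = 0. Proof. by rewrite /hgt big_nil. Qed.

Lemma hgt_cons b s : hgt (b :: s) = 2 * b%:R - 1 + hgt s.
Proof. by rewrite /hgt big_cons. Qed.

Lemma hgt_cat s t : hgt (s ++ t) = hgt s + hgt t.
Proof. by rewrite /hgt big_cat. Qed.

(** The erased letters alternate, starting with the opposite of [p], so their signs add up to the
    last letter minus [p]. *)
Lemma hgt_red (p : bool) s : hgt s + (p : nat)%:Z = hgt (red p s) + (last p s : nat)%:Z.
Proof.
elim: s p => [//|b s IH] p /=; have := IH b.
by case: ifP => [/eqP ->|]; rewrite !hgt_cons; case: b; case: p => //=; lia.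
Qed.

(** Excursions are the words [false :: s] with [s] of this kind. *)
Definition dyck (s : seq bool) : Prop :=
  (forall m, 0 <= hgt (take m s)) /\ hgt s = 0.

(** The reduced path sits at the current height minus the last letter read, starting from [h]. This
    is nonnegative, as a letter 1 read from a nonnegative height leads to height at least 1. *)
Lemma hgt_red_ge0 (p : bool) h s : 0 <= h - (p : nat)%:Z ->
  (forall m, 0 <= h + hgt (take m s)) ->
  forall m, 0 <= h - (p : nat)%:Z + hgt (take m (red p s)).
Proof.
elim: s p h => [|b s IH] p h hp hs m /=; first by rewrite hgt_nil addr0.
have h1 : 0 <= h + (2 * b%:R - 1) by have := hs 1%N; rewrite /= take0 hgt_cons hgt_nil addr0.
have hs' j : 0 <= h + (2 * b%:R - 1) + hgt (take j s).
  by have := hs j.+1; rewrite /= hgt_cons addrA.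
case: ifP => [/eqP bp|bp].
  subst b; have hp' : 0 <= h + (2 * p%:R - 1) - (p : nat)%:Z.
    by move: h1 hp; case: p {hs hs' IH} => /=; lia.
  case: m => [|m]; first by rewrite take0 hgt_nil addr0.
  have := IH p _ hp' hs' m.
  by rewrite /= hgt_cons; lia.
have hE : h + (2 * b%:R - 1) - (b : nat)%:Z = h - (p : nat)%:Z.
  by move: bp; case: b {h1 hs hs' IH}; case: p {hp} => //= _; lia.
by rewrite -hE; apply: IH => //; rewrite hE.
Qed.

Lemma dyck_last s : dyck s -> last false s = false.
Proof.
case: (lastP s) => [//|t b] [hpre htot]; rewrite last_rcons.
case: b hpre htot => // hpre; rewrite -cats1 hgt_cat hgt_cons hgt_nil => htot.
have := hpre (size t); rewrite -cats1 take_size_cat //; lia.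
Qed.

Lemma dyck_red s :
  dyck s <-> last false s = false /\ dyck (red false s).
Proof.
split=> [ds|[lf [hpre htot]]].
  have lf := dyck_last ds; split=> //; case: ds => hpre htot.
  split; last by have := hgt_red false s; rewrite htot lf; lia.
  move=> m; have := @hgt_red_ge0 false 0 s isT.
  by rewrite subr0 => /(_ _ m); rewrite add0r; apply => j; rewrite add0r.
split; last by have := hgt_red false s; rewrite htot lf; lia.
move=> m; have := hgt_red false (take m s).
have := hpre (size (red false (take m s))).
rewrite -{2}(cat_take_drop m s) red_cat take_size_cat //; lia.
Qed.

(** A nonempty Dyck word starts with 1, which differs from the preceding 0 and is erased. Hence
    repeated reduction ends at the empty word. *)
Lemma size_red_dyck s : dyck s -> s != [::] -> (size (red false s) < size s)%N.
Proof.
case: s => [//|[] s] [hpre _] _ /=; first by rewrite ltnS size_red.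
by have := hpre 1%N; rewrite /= take0 hgt_cons hgt_nil.
Qed.

(* Dyck words all of whose balls sit on the first K seats. *)
Fixpoint level (K : nat) (s : seq bool) : bool :=
  if K is K'.+1 then (last false s == false) && level K' (red false s)
  else s == [::].

Lemma level_dyck K s : level K s -> dyck s.
Proof.
elim: K s => [|K IH] s /=.
  by move=> /eqP ->; split=> [m|]; rewrite ?take_oversize // hgt_nil.
by move=> /andP[/eqP lf /IH ds]; apply/dyck_red.
Qed.

Lemma dyck_level s : dyck s -> exists K, level K s.
Proof.
have [n] := ubnP (size s); elim: n s => // n IH s hn ds.
have [->|s0] := eqVneq s [::]; first by exists 0%N.
have [lf dr] := (dyck_red s).1 ds.
have [|K hK] := IH (red false s) _ dr.
  exact: leq_trans (size_red_dyck ds s0) hn.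
by exists K.+1; rewrite /= lf hK.
Qed.

Lemma levelS K s : level K s -> level K.+1 s.
Proof.
elim: K s => [|K IH] s; first by move=> /eqP ->.
by move=> /andP[lf h]; rewrite [level _ _]/= lf /=; exact: IH.
Qed.

Lemma level_le K K' s : (K <= K')%N -> level K s -> level K' s.
Proof.
move=> /subnKC <-; elim: (K' - K)%N => [|n IH]; first by rewrite addn0.
by move=> h; rewrite addnS; apply: levelS; exact: IH.
Qed.

Lemma run_dyck s : dyck s -> run empty s = empty.
Proof.
move=> /dyck_level[K]; elim: K s => [|K IH] s; first by move=> /eqP ->.
move=> /andP[/eqP lf /IH h]; apply/funext => -[|k]; first by rewrite run0.
by have /(congr1 (fun f => f k)) := upper_run empty s; rewrite /upper h.
Qed.

(** [s1] ends where the path last reaches a new minimum. There a Dyck word has just emptied the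
    seats and is followed by a 0, which does nothing to empty seats. *)
Lemma run_split s : exists s1 s2,
  [/\ s = s1 ++ s2, run empty s1 = empty & forall m, 0 <= hgt (take m s2)].
Proof.
elim/last_ind: s => [|s b [s1 [s2 [-> r1 h2]]]].
  by exists [::], [::]; split=> // m; rewrite hgt_nil.
have [h|h] := lerP 0 (hgt (rcons s2 b)).
  exists s1, (rcons s2 b); split; rewrite ?rcons_cat // => m.
  rewrite -cats1 take_cat; case: ltnP => hm; first exact: h2.
  case: (m - size s2)%N => [|j]; last by rewrite /= -cats1 in h *.
  by rewrite take0 cats0; have := h2 (size s2); rewrite take_size.
exists (s1 ++ rcons s2 b), [::]; split=> [||m]; rewrite ?cats0 ?rcons_cat ?hgt_nil //.
have h0 := h2 (size s2); rewrite take_size in h0.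
move: h; rewrite -cats1 hgt_cat hgt_cons hgt_nil; case: b => h; first by move: h; lia.
rewrite cats1 -rcons_cat -cats1 !run_cat r1 run_dyck ?step_false_empty //=.
  exact: step_false_empty.
by split=> //; move: h; lia.
Qed.

(** The hypothesis says that a record ends the word. The second part given by [run_split] must be
    empty, being otherwise a suffix of nonnegative height. *)
Lemma run_suffix_lt0 s :
  (forall m, (m < size s)%N -> hgt (drop m s) < 0) -> run empty s = empty.
Proof.
have [s1 [s2 [-> r1 h2]]] := run_split s => h.
have [s20|] := posnP (size s2); first by rewrite (size0nil s20) cats0.
move=> s2p; have := h (size s1); rewrite size_cat drop_size_cat //.
rewrite -{1}[size s1]addn0 ltn_add2l s2p => /(_ isT).
by have := h2 (size s2); rewrite take_size; lia.
Qed.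

(** * Inverting the reduction *)

Fixpoint alt (p : bool) (n : nat) : seq bool :=
  if n is n'.+1 then ~~ p :: alt (~~ p) n' else [::].

(* Number of letters erased between consecutive surviving letters a and b:
   the erased ones alternate and the last of them equals b. *)
Definition gap (a b : bool) (n : nat) : nat := (n.*2 + (a != b))%N.

(** There is one slot after each surviving letter and one after the initial letter [p]; the last gap
    leads to the 0 that follows the word. *)
Fixpoint fill (p : bool) (t : seq bool) (ns : seq nat) : seq bool :=
  match t, ns with
  | b :: t', n :: ns' => alt p (gap p b n) ++ b :: fill b t' ns'
  | [::], n :: _ => alt p (gap p false n)
  | _, [::] => [::]
  end.

(** [c] counts the letters erased since the last survivor; half of it, rounded down, is the number
    of pairs, inverting [gap]. *)
Fixpoint slots (p : bool) (c : nat) (s : seq bool) : seq nat :=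
  if s is b :: s' then
    if b == p then c./2 :: slots b 0 s' else slots b c.+1 s'
  else [:: c./2].

Lemma size_slots p c s : size (slots p c s) = (size (red p s)).+1.
Proof. by elim: s p c => [//|b s IH] p c /=; case: ifP => _ /=; rewrite IH. Qed.

Lemma altSr p n : alt p n.+1 = rcons (alt p n) (p (+) ~~ odd n).
Proof.
elim: n p => [|n IH] p; first by rewrite /= addbT.
by rewrite [LHS]/= -/(alt (~~ p) n.+1) IH /=; case: p; case: (odd n).
Qed.

Lemma last_alt p n : last p (alt p n) = p (+) odd n.
Proof. by case: n => [|n]; rewrite ?addbF // altSr last_rcons. Qed.

Lemma red_alt p n s : red p (alt p n ++ s) = red (p (+) odd n) s.
Proof.
elim: n p => [|n IH] p /=; first by rewrite addbF.
by rewrite IH; case: p => //=; case: (odd n).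
Qed.

Lemma odd_gap a b n : odd (gap a b n) = (a != b).
Proof. by rewrite oddD odd_double oddb. Qed.

Lemma addb_gap a b n : a (+) odd (gap a b n) = b.
Proof. by rewrite odd_gap; case: a; case: b. Qed.

Lemma gap_half p b c : p (+) odd c = b -> gap p b c./2 = c.
Proof.
by move=> <-; rewrite /gap -[RHS]odd_double_half addnC; case: p; case: (odd c).
Qed.

Lemma half_gap p b n : (gap p b n)./2 = n.
Proof. by rewrite /gap halfD odd_double doubleK; case: (p != b); rewrite /= addn0. Qed.

Lemma gap_mul a b n x : (gap a b n * x = (n * x).*2 + (a != b) * x)%N.
Proof. by rewrite /gap mulnDl doubleMl. Qed.

Lemma red_fill p t ns : size ns = (size t).+1 -> red p (fill p t ns) = t.
Proof.
elim: t p ns => [|b t IH] p [//|n ns] [hs] /=.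
  by rewrite -[alt _ _]cats0 red_alt.
by rewrite red_alt addb_gap /= eqxx IH.
Qed.

Lemma last_fill p t ns : size ns = (size t).+1 -> last p (fill p t ns) = false.
Proof.
elim: t p ns => [|b t IH] p [//|n ns] [hs] /=.
  by rewrite last_alt addb_gap.
by rewrite last_cat /= IH.
Qed.

Lemma slots_alt p c n s : slots p c (alt p n ++ s) = slots (p (+) odd n) (c + n) s.
Proof.
elim: n p c => [|n IH] p c /=; first by rewrite addbF addn0.
by case: p; rewrite /= IH addSnnS /=; case: (odd n).
Qed.

Lemma slots_fill p t ns : size ns = (size t).+1 -> slots p 0 (fill p t ns) = ns.
Proof.
elim: t p ns => [|b t IH] p [//|n ns] [hs] /=.
  by rewrite -[alt _ _]cats0 slots_alt /= add0n half_gap (size0nil hs).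
by rewrite slots_alt addb_gap /= eqxx add0n half_gap IH.
Qed.

(** Generalized for the induction: [p] is the last survivor and [c] letters have been erased since,
    so the last letter read is [p (+) odd c]. *)
Lemma fill_slots_alt p c s : last (p (+) odd c) s = false ->
  fill p (red (p (+) odd c) s) (slots (p (+) odd c) c s) = alt p c ++ s.
Proof.
elim: s p c => [|b s IH] p c /=.
  by move=> h; rewrite gap_half // cats0.
case: eqP => [->|/eqP bp] lf /=.
  rewrite gap_half //; congr (_ ++ _ :: _).
  have := IH (p (+) odd c) 0%N; rewrite /= addbF; exact.
have bE : b = p (+) odd c.+1 by move: bp; rewrite /=; case: b lf; case: p; case: (odd c).
have := IH p c.+1; rewrite -bE => ->; last by [].
by rewrite altSr -cats1 -catA bE.
Qed.

Lemma fill_slots p s : last p s = false -> fill p (red p s) (slots p 0 s) = s.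
Proof. by have := @fill_slots_alt p 0 s; rewrite /= addbF. Qed.

(** * Observables of the seat process *)

Fixpoint tot (o : (nat -> bool) -> nat) (w : nat -> bool) (s : seq bool) : nat :=
  if s is b :: s' then (o (step b w) + tot o (step b w) s')%N else 0%N.

(* Sum of o over the sites followed by a different letter; the letter after
   the word is 0, as it is after an excursion. *)
Fixpoint turn (o : (nat -> bool) -> nat) (w : nat -> bool) (s : seq bool) : nat :=
  if s is b :: s' then ((w 0%N != b) * o w + turn o (step b w) s')%N
  else (w 0%N * o w)%N.

(** The coefficient of a slot is the value of [o] at the survivor preceding it, a value which every
    pair inserted there repeats. *)
Fixpoint wsum (o : (nat -> bool) -> nat) (w : nat -> bool) (t : seq bool)
    (ns : seq nat) : nat :=
  if ns is n :: ns' then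
    (n * o w + if t is b :: t' then wsum o (step b w) t' ns' else 0)%N
  else 0%N.

Definition lift (o : (nat -> bool) -> nat) (w : nat -> bool) : nat := o (upper w).

Lemma run_alt w n : upper (run w (alt (w 0%N) n)) = upper w.
Proof. by rewrite upper_run -[alt _ _]cats0 red_alt. Qed.

Lemma tot_cat o w s t : tot o w (s ++ t) = (tot o w s + tot o (run w s) t)%N.
Proof. by elim: s w => [//|b s IH] w /=; rewrite IH addnA. Qed.

Lemma tot_lift_alt o w n : tot (lift o) w (alt (w 0%N) n) = (n * lift o w)%N.
Proof.
elim: n w => [//|n IH] w /=.
have := IH (step (~~ w 0%N) w); rewrite step0 => ->.
by rewrite mulSn /lift upper_step; case: (w 0%N).
Qed.

Lemma turn_lift_alt o w n s :
  turn (lift o) w (alt (w 0%N) n ++ s) =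
  (n * lift o w + turn (lift o) (run w (alt (w 0%N) n)) s)%N.
Proof.
elim: n w => [//|n IH] w /=.
have := IH (step (~~ w 0%N) w); rewrite step0 => ->.
rewrite addnA mulSn; congr (_ + _ + _)%N; first by case: (w 0%N) => /=; rewrite mul1n.
by rewrite /lift upper_step; case: (w 0%N).
Qed.

Lemma run_alt0 w n : run w (alt (w 0%N) n) 0%N = w 0%N (+) odd n.
Proof. by rewrite run0 last_alt. Qed.

(* The hypothesis w 0 = w 1 says that the last letter read survives. *)
Lemma turn_fill o w t ns : size ns = (size t).+1 -> w 0%N = w 1%N ->
  turn (lift o) w (fill (w 0%N) t ns) =
  (turn o (upper w) t + (wsum o (upper w) t ns).*2)%N.
Proof.
elim: t w ns => [|b t IH] w [//|n ns] [hs] hw /=;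
  have u0 : upper w 0%N = w 0%N by rewrite /upper hw.
  rewrite -[alt _ _]cats0 turn_lift_alt /= run_alt0 addb_gap mul0n addn0 addn0.
  by rewrite u0 gap_mul /lift addnC; case: (w 0%N).
rewrite turn_lift_alt /= run_alt0 addb_gap eqxx mul0n add0n.
set w' := run _ _.
have uw' : upper w' = upper w by exact: run_alt.
have w'0 : w' 0%N = b by rewrite /w' run_alt0 addb_gap.
have us : upper (step b w') = step b (upper w) by rewrite upper_step w'0 eqxx uw'.
have := IH (step b w') ns hs; rewrite step0 us => ->.
  rewrite doubleD addnACA; congr (_ + _)%N.
  by rewrite gap_mul u0 addnC.
by have := congr1 (fun f => f 0%N) us; rewrite /upper step0 => ->.
Qed.

(** The gap after a survivor has 2n letters, collected in [wsum], plus one if the next survivor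
    differs, collected in [turn]; at all of them the upper seats are those of the survivor. *)
Lemma tot_fill o w t ns : size ns = (size t).+1 -> w 0%N = w 1%N ->
  tot (lift o) w (fill (w 0%N) t ns) =
  (tot o (upper w) t + turn o (upper w) t + (wsum o (upper w) t ns).*2)%N.
Proof.
elim: t w ns => [|b t IH] w [//|n ns] [hs] hw /=;
  have u0 : upper w 0%N = w 0%N by rewrite /upper hw.
  rewrite tot_lift_alt addn0 add0n.
  by rewrite u0 gap_mul /lift addnC; case: (w 0%N).
rewrite tot_cat tot_lift_alt /=.
set w' := run _ _.
have uw' : upper w' = upper w by exact: run_alt.
have w'0 : w' 0%N = b by rewrite /w' run_alt0 addb_gap.
have us : upper (step b w') = step b (upper w) by rewrite upper_step w'0 eqxx uw'.
have := IH (step b w') ns hs; rewrite step0 us => ->; last first.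
  by have := congr1 (fun f => f 0%N) us; rewrite /upper step0 => ->.
have -> : lift o (step b w') = o (step b (upper w)) by rewrite /lift us.
have -> : (gap (w 0%N) b n * lift o w = (n * o (upper w)).*2 +
   (upper w 0%N != b) * o (upper w))%N.
  by rewrite gap_mul u0.
by rewrite doubleD; lia.
Qed.

Definition seat_obs (k : nat) (w : nat -> bool) : nat := w k.
Definition site_obs (w : nat -> bool) : nat := 1%N.

Lemma lift_seat k : lift (seat_obs k) = seat_obs k.+1. Proof. by []. Qed.
Lemma lift_site : lift site_obs = site_obs. Proof. by []. Qed.

Lemma tot_site w s : tot site_obs w s = size s.
Proof. by elim: s w => [//|b s IH] w /=; rewrite IH. Qed.

(** Changes of letter alternate between 0 to 1 and 1 to 0 and end with the latter, the word being
    followed by 0. Seat 1 sees only the changes from 1 to 0. *)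
Lemma turn_seat0 w s :
  (turn site_obs w s + w 0%N = (turn (seat_obs 0) w s).*2)%N.
Proof.
elim: s w => [|b s IH] w /=.
  by rewrite /seat_obs /site_obs; case: (w 0%N).
have := IH (step b w); rewrite step0 /seat_obs /site_obs doubleD => <-.
by case: (w 0%N); case: b => /=; lia.
Qed.

Lemma tot_seat0 w s : (((tot (seat_obs 0) w s).*2)%:Z = hgt s + (size s)%:Z).
Proof.
elim: s w => [|b s IH] w /=; first by rewrite hgt_nil.
rewrite hgt_cons doubleD /seat_obs step0 PoszD.
by have := IH (step b w); rewrite /seat_obs => ->; case: b => /=; lia.
Qed.

(** * Geometric sums *)

Section GeometricSums.
Variable R : realType.
Implicit Types x : R.

Lemma sum_nat_geometric x n :
  (1 - x) ^+ 2 * \sum_(0 <= i < n) (i%:R * x ^+ i) =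
  x - n%:R * x ^+ n + (n%:R - 1) * x ^+ n.+1.
Proof.
elim: n => [|n IH]; first by rewrite big_geq // expr0 expr1; ring.
rewrite big_nat_recr //= mulrDr IH -natr1 !exprS; ring.
Qed.

Lemma is_cvg_nat_geometric x : 0 <= x < 1 ->
  cvgn (series (fun n => n%:R * x ^+ n)).
Proof.
move=> /andP[x0 x1]; apply: nondecreasing_is_cvgn.
  by apply: nondecreasing_series => n _ _; rewrite mulr_ge0 // exprn_ge0.
have p0 : 0 < (1 - x) ^+ 2 by rewrite exprn_gt0 // subr_gt0.
exists (x / (1 - x) ^+ 2) => _ [n _ <-].
rewrite ler_pdivlMr // mulrC /series /= sum_nat_geometric.
have h : (n%:R - 1) * x ^+ n.+1 <= n%:R * x ^+ n.
  rewrite exprS mulrA ler_wpM2r ?exprn_ge0 //.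
  have [->|n0] := posnP n; first by lra.
  have : (1 : R) <= n%:R by rewrite ler1n.
  by move=> h; nra.
lra.
Qed.

Lemma cvg_nat_expr x : 0 <= x < 1 -> (fun n => n%:R * x ^+ n) @ \oo --> (0 : R).
Proof. by move=> /is_cvg_nat_geometric/cvg_series_cvg_0. Qed.

Lemma cvg_expr_0 x : 0 <= x < 1 -> (fun n => x ^+ n) @ \oo --> (0 : R).
Proof. by move=> /andP[x0 x1]; apply: cvg_expr; rewrite ger0_norm. Qed.

Definition geo x (n : nat) : R := (1 - x) * x ^+ n.

Lemma geo_ge0 x n : 0 <= x < 1 -> 0 <= geo x n.
Proof.
by move=> /andP[x0 x1]; rewrite mulr_ge0 ?exprn_ge0 // subr_ge0 ltW.
Qed.

(** The mean of the geometric law [geo x]. *)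
Definition odds x : R := x / (1 - x).

Lemma odds_ge0 x : 0 <= x < 1 -> 0 <= odds x.
Proof. by move=> /andP[x0 x1]; rewrite divr_ge0 // subr_ge0 ltW. Qed.

Lemma esum_lim (a : nat -> R) (l : R) : (forall n, 0 <= a n) ->
  series a @ \oo --> l -> (\esum_(n in [set: nat]) (a n)%:E = l%:E)%E.
Proof.
move=> a0 al; rewrite -nneseries_esumT => [|n]; last by rewrite lee_fin.
apply/cvg_lim => //; rewrite (_ : (fun n => _) = EFin \o series a).
  by apply/fine_cvgP; split; [apply: nearW|].
by apply/funext => n /=; rewrite sumEFin.
Qed.

Lemma esum_geo_affine x (a b : R) : 0 <= x < 1 -> 0 <= a -> 0 <= b ->
  (\esum_(n in [set: nat]) (geo x n * (a + b * n%:R))%:E =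
   (a + b * odds x)%:E)%E.
Proof.
move=> hx a0 b0; have /andP[x0 x1] := hx; have y0 : 1 - x != 0 by lra.
apply: esum_lim => [n|].
  by rewrite mulr_ge0 ?geo_ge0 // addr_ge0 // mulr_ge0.
(* Closed form of the partial sums, arranged so that only [x ^+ n] and [n%:R * x ^+ n], which tend
   to 0, depend on [n]. *)
pose c n : R := a * (1 - x ^+ n) +
  b / (1 - x) * (x - n%:R * x ^+ n + (n%:R * x ^+ n - x ^+ n) * x).
have -> : series (fun n => geo x n * (a + b * n%:R)) = c.
  apply/funext => n; rewrite /series /= /c.
  transitivity (a * ((1 - x) * \sum_(0 <= i < n) x ^+ i) +
     b / (1 - x) * ((1 - x) ^+ 2 * \sum_(0 <= i < n) (i%:R * x ^+ i))).
    rewrite !mulr_sumr -big_split /=; apply: eq_bigr => i _.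
    by rewrite /geo; field.
  rewrite sum_nat_geometric big_mkord; congr (_ * _ + _ * _).
    by rewrite -[RHS]opprB subrX1 -mulNr opprB.
  by rewrite exprS; ring.
have -> : a + b * odds x = a * (1 - 0) + b / (1 - x) * (x - 0 + (0 - 0) * x).
  by rewrite /odds; field.
have c1 := cvg_expr_0 hx; have c2 := cvg_nat_expr hx.
apply: cvgD; apply: cvgM; try exact: cvg_cst.
  by apply: cvgB => //; exact: cvg_cst.
apply: cvgD; first by apply: cvgB => //; exact: cvg_cst.
by apply: cvgM; [exact: cvgB|exact: cvg_cst].
Qed.

Lemma esumZl (T : choiceType) (I : set T) (a : T -> \bar R) (r : R) :
  (forall i, (0 <= a i)%E) -> 0 <= r ->
  (\esum_(i in I) (r%:E * a i) = r%:E * \esum_(i in I) a i)%E.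
Proof.
move=> a0 r0; rewrite /esum -ereal_supZl //; last first.
  by apply/set0P; exists (\sum_(x \in set0) a x)%E, set0 => //; exact: fsets_set0.
congr ereal_sup; apply/seteqP; split => [_ [A hA <-]|_ [_ [A hA <-] <-]] /=.
  exists (\sum_(x \in A) a x)%E; first by exists A.
  by rewrite ge0_mule_fsumr.
by exists A => //; rewrite ge0_mule_fsumr.
Qed.

Definition geos x (ns : seq nat) : R := \prod_(n <- ns) geo x n.

(** Each slot has mean [odds x], and the coefficients in [wsum] add up to the total of [o] over the
    word and its initial site. Arbitrary constants [a] and [b] let the induction absorb the first
    slot into [a] and its probability into both. *)
Lemma esum_geos_affine x o w t (a b : R) :
  0 <= x < 1 -> 0 <= a -> 0 <= b ->
  (\esum_(ns in [set ns | size ns = (size t).+1])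
     (geos x ns * (a + b * (wsum o w t ns)%:R))%:E =
   (a + b * (o w + tot o w t)%:R * odds x)%:E)%E.
Proof.
move=> hx; have geo0 n := geo_ge0 n hx; have odds0 := odds_ge0 hx.
have geos0 ns : 0 <= geos x ns by apply: prodr_ge0.
elim: t w a b => [|l t IH] w a b a0 b0.
  have -> : [set ns : seq nat | size ns = (size (@nil bool)).+1] =
      (fun n => [:: n]) @` [set: nat].
    apply/seteqP; split => [[|n [|//]] //= _|_ [n _ <-]//]; by exists n.
  rewrite esum_image /=; last by move=> n m _ _ [].
  rewrite addn0 -esum_geo_affine ?mulr_ge0 //; apply: eq_esum => n _.
  by rewrite /geos big_seq1 /= addn0 natrM -mulrA [n%:R * _]mulrC.
have -> : [set ns : seq nat | size ns = (size (l :: t)).+1] =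
   (fun p : nat * seq nat => p.1 :: p.2) @`
     ([set: nat] `*`` (fun=> [set ns | size ns = (size t).+1])).
  apply/seteqP; split => [[|n ns] //= [h]|_ [[n ns] [_ /= h] <-]/=]; last by rewrite h.
  by exists (n, ns).
rewrite esum_image; last by move=> [n ns] [m ms] _ _ /= [-> ->].
rewrite -(esum_esum (a := fun n ns => (geos x (n :: ns) *
   (a + b * (wsum o w (l :: t) (n :: ns))%:R))%:E)); last first.
  by move=> n ns _ _; rewrite lee_fin mulr_ge0 // addr_ge0 // mulr_ge0.
transitivity (\esum_(n in [set: nat]) (geo x n *
   ((a + b * (o (step l w) + tot o (step l w) t)%:R * odds x) + b * (o w)%:R * n%:R))%:E)%E.
  apply: eq_esum => n _.
  transitivity (\esum_(ns in [set ns | size ns = (size t).+1])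
     (geos x ns * (geo x n * (a + b * (n * o w)%:R) +
        geo x n * b * (wsum o (step l w) t ns)%:R))%:E)%E.
    apply: eq_esum => ns _; congr EFin.
    by rewrite /geos big_cons /= natrD; ring.
  rewrite IH; [|by rewrite mulr_ge0 // addr_ge0 // mulr_ge0|exact: mulr_ge0].
  by congr EFin; rewrite natrM; ring.
rewrite esum_geo_affine; [|by []|by rewrite addr_ge0 // mulr_ge0 // mulr_ge0|exact: mulr_ge0].
by congr EFin; rewrite /= !natrD; ring.
Qed.

End GeometricSums.

(** * Weighted sums over Dyck words of bounded level *)

Definition rsize k s := size (iter k (red false) s).

(* Number of solitons of size larger than k in the excursion false :: s. *)
Definition ups k s := turn (seat_obs 0) empty (iter k (red false) s).

Lemma wsum_site w t ns : size ns = (size t).+1 -> wsum site_obs w t ns = sumn ns.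
Proof.
elim: t w ns => [|b t IH] w [//|n ns] [hs] /=.
  by rewrite (size0nil hs) /site_obs muln1.
by rewrite IH // /site_obs muln1.
Qed.

Lemma turn_site_fill t ns : size ns = (size t).+1 ->
  turn site_obs empty (fill false t ns) =
  (turn site_obs empty t + (sumn ns).*2)%N.
Proof.
move=> hs; have := @turn_fill site_obs empty t ns hs erefl.
by rewrite wsum_site // lift_site.
Qed.

(** Each inserted pair adds one turn from 1 to 0: the pairs are the solitons of size 1. *)
Lemma ups_fill t ns : size ns = (size t).+1 ->
  ups 0 (fill false t ns) = (ups 0 t + sumn ns)%N.
Proof.
move=> hs; apply: double_inj; rewrite doubleD -!turn_seat0 !addn0.
exact: turn_site_fill.
Qed.

Lemma size_red_ups s : last false s = false ->
  size s = (size (red false s) + (ups 0 s).*2)%N.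
Proof.
move=> hl; have hs := size_slots false 0 s.
rewrite -{1 3}(fill_slots hl) /ups /= -turn_seat0 addn0 turn_site_fill // -(tot_site empty).
rewrite -[in LHS]lift_site (@tot_fill site_obs empty _ _ hs erefl).
by rewrite wsum_site // tot_site addnA.
Qed.

Lemma ups_red s : last false s = false -> (ups 1 s <= ups 0 s)%N.
Proof.
move=> hl; have hs := size_slots false 0 s.
by rewrite -{2}(fill_slots hl) ups_fill // leq_addr.
Qed.

Lemma ups_iter j k s : ups (k + j) s = ups k (iter j (red false) s).
Proof. by rewrite /ups iterD. Qed.

Lemma dyck_iter k s : dyck s -> dyck (iter k (red false) s).
Proof. by move=> ds; elim: k => //= k /dyck_red[]. Qed.

Lemma ups_anti k s : dyck s -> (ups k.+1 s <= ups k s)%N.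
Proof.
move=> /(dyck_iter k)/dyck_last/ups_red.
by rewrite -!ups_iter add0n add1n.
Qed.

Lemma rsize_ups k s : dyck s -> rsize k s = (rsize k.+1 s + (ups k s).*2)%N.
Proof.
move=> /(dyck_iter k)/dyck_last/size_red_ups.
by rewrite -[ups 0 _]ups_iter add0n.
Qed.

Lemma level_iter_nil K s : level K s -> iter K (red false) s = [::].
Proof.
elim: K s => [|K IH] s; first by move=> /eqP.
by move=> /andP[_ /IH h]; rewrite iterSr.
Qed.

Lemma level_iter_ge K k s : level K s -> (K <= k)%N -> iter k (red false) s = [::].
Proof. by move=> h hk; apply: level_iter_nil; exact: level_le h. Qed.

Definition shiftq (R : Type) (q : nat -> R) (k : nat) : R := q k.+1.

(* The first K factors of varphi q at the excursion false :: s. *)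
Definition wt (R : realType) (K : nat) (q : nat -> R) (s : seq bool) : R :=
  \prod_(0 <= k < K) (q k.+1 ^+ (ups k s - ups k.+1 s) *
                      (1 - q k.+1) ^+ (rsize k.+1 s).+1).

Section Expectations.
Variable R : realType.
Implicit Types q : nat -> R.

Definition unit_weights q := forall k, (0 < k)%N -> 0 <= q k < 1.

Lemma unit_weights_shift q : unit_weights q -> unit_weights (shiftq q).
Proof. by move=> hq k _; exact: hq. Qed.

Lemma wt_ge0 K q s : unit_weights q -> 0 <= wt K q s.
Proof.
move=> hq; apply: prodr_ge0 => k _; have /andP[q0 q1] := hq k.+1 isT.
by rewrite mulr_ge0 // exprn_ge0 // subr_ge0 ltW.
Qed.

Lemma geosE (x : R) ns : geos x ns = x ^+ sumn ns * (1 - x) ^+ size ns.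
Proof.
elim: ns => [|n ns IH]; first by rewrite /geos big_nil mulr1.
by rewrite /geos big_cons -/(geos x ns) IH /= /geo exprD exprS; ring.
Qed.

(** The first factor is exactly the joint geometric law of the slots, one for each site of the
    reduced excursion; the other factors see only the reduced word. *)
Lemma wt_fill K q t ns : size ns = (size t).+1 ->
  wt K.+1 q (fill false t ns) = geos (q 1%N) ns * wt K (shiftq q) t.
Proof.
move=> hs; rewrite /wt big_nat_recl //; congr (_ * _).
  rewrite geosE ups_fill // hs /rsize /= /ups /= red_fill //.
  by rewrite addKn.
apply: eq_bigr => k _.
by rewrite /ups /rsize !iterSr red_fill.
Qed.

(** Expectation under the weights [(q 1, ..., q K, 0, 0, ...)], which are carried by words of level
    [K]. It lives in the extended reals, and finiteness comes out of the recursion. *)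
Definition expect K q (F : seq bool -> R) : \bar R :=
  (\esum_(s in [set s | level K s]) (wt K q s * F s)%:E)%E.

Lemma eq_expect K q F G : (forall s, level K s -> F s = G s) ->
  expect K q F = expect K q G.
Proof. by move=> FG; apply: eq_esum => s /FG ->. Qed.

Lemma expectD K q F G : unit_weights q ->
  (forall s, 0 <= F s) -> (forall s, 0 <= G s) ->
  expect K q (fun s => F s + G s) = (expect K q F + expect K q G)%E.
Proof.
move=> hq F0 G0; rewrite /expect -esumD; last 2 first.
- by move=> s _; rewrite lee_fin mulr_ge0 // wt_ge0.
- by move=> s _; rewrite lee_fin mulr_ge0 // wt_ge0.
by apply: eq_esum => s _; rewrite -EFinD mulrDr.
Qed.

Lemma expectZ K q F (r : R) : unit_weights q ->
  (forall s, 0 <= F s) -> 0 <= r ->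
  expect K q (fun s => r * F s) = (r%:E * expect K q F)%E.
Proof.
move=> hq F0 r0; rewrite /expect -esumZl //.
  by apply: eq_esum => s _; rewrite -EFinM mulrCA.
by move=> s; rewrite lee_fin mulr_ge0 // wt_ge0.
Qed.

Lemma level_image K : [set s | level K.+1 s] =
  (fun p : seq bool * seq nat => fill false p.1 p.2) @`
    ([set t | level K t] `*`` (fun t => [set ns | size ns = (size t).+1])).
Proof.
apply/seteqP; split => [s /= /andP[/eqP lf ls]|_ [[t ns] [/= lt hs] <-]].
  exists (red false s, slots false 0 s); last exact: fill_slots.
  by split => //=; rewrite size_slots.
by rewrite /= last_fill // red_fill // eqxx.
Qed.

(* Summing over the erased letters first: given the reduced word, the numbers
   of erased pairs are independent geometric variables of parameter q 1. *)
Lemma expect_fill K q (F A : seq bool -> R) (b : R) o :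
  unit_weights q -> (forall t, 0 <= A t) -> 0 <= b ->
  (forall t ns, level K t -> size ns = (size t).+1 ->
    F (fill false t ns) = A t + b * (wsum o empty t ns)%:R) ->
  expect K.+1 q F = expect K (shiftq q)
    (fun t => A t + b * (o empty + tot o empty t)%:R * odds (q 1%N)).
Proof.
move=> hq A0 b0 hF; have hq1 := hq 1%N isT.
rewrite /expect level_image esum_image; last first.
  move=> [t ns] [t' ns'] /=; rewrite !inE /= => -[_ hs] [_ hs'] e.
  have et : t = t' by rewrite -(red_fill false hs) e red_fill.
  by congr pair => //; rewrite -(slots_fill false hs) e slots_fill.
rewrite -(esum_esum (a := fun t ns => (wt K.+1 q (fill false t ns) *
  F (fill false t ns))%:E)); last first.
  move=> t ns lt hs; rewrite lee_fin mulr_ge0 ?wt_ge0 // hF // addr_ge0 //.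
  by rewrite mulr_ge0.
apply: eq_esum => t lt; have w0 := wt_ge0 K t (unit_weights_shift hq).
transitivity (\esum_(ns in [set ns | size ns = (size t).+1])
  (geos (q 1%N) ns * (wt K (shiftq q) t * A t +
     wt K (shiftq q) t * b * (wsum o empty t ns)%:R))%:E)%E.
  apply: eq_esum => ns hs; congr EFin.
  by rewrite wt_fill // hF //; ring.
rewrite esum_geos_affine //; [|exact: mulr_ge0|exact: mulr_ge0].
by congr EFin; ring.
Qed.

Lemma expect1 K q : unit_weights q -> expect K q (fun=> 1) = 1%E.
Proof.
elim: K q => [|K IH] q hq.
  rewrite /expect (_ : [set s | _] = [set [::]]) ?esum_set1 //.
  - by rewrite /wt big_geq // mulr1.
  - by rewrite lee_fin mulr_ge0 // wt_ge0.
  - by apply/seteqP; split => s /eqP.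
rewrite (@expect_fill K q _ (fun=> 1) 0 site_obs) // => [|t ns _ _].
  rewrite -[RHS](IH (shiftq q)) => [|k _]; last exact: hq.
  by apply: eq_expect => s _; rewrite !mul0r addr0.
by rewrite mul0r addr0.
Qed.

(* Expectations over a whole excursion: the initial site 0 precedes s. *)
Definition etot (o : (nat -> bool) -> nat) (s : seq bool) : R :=
  (o empty + tot o empty s)%:R.
Definition eturn (o : (nat -> bool) -> nat) (s : seq bool) : R :=
  (turn o empty s)%:R.

Lemma expect_lift K q o (a b : R) : unit_weights q ->
  expect K (shiftq q) (etot o) = a%:E ->
  expect K (shiftq q) (eturn o) = b%:E ->
  expect K.+1 q (etot (lift o)) = (a + (b + 2 * odds (q 1%N) * a))%:E /\
  expect K.+1 q (eturn (lift o)) = (b + 2 * odds (q 1%N) * a)%:E.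
Proof.
move=> hq ha hb; have m0 := odds_ge0 (hq 1%N isT).
have hq' := unit_weights_shift hq.
have e0 s : 0 <= etot o s by exact: ler0n.
have t0 s : 0 <= eturn o s by exact: ler0n.
have m2 : 0 <= 2 * odds (q 1%N) by exact: mulr_ge0.
have hbb : expect K (shiftq q) (fun t => eturn o t + 2 * odds (q 1%N) * etot o t) =
    (b + 2 * odds (q 1%N) * a)%:E.
  rewrite expectD // => [|s]; last exact: mulr_ge0.
  by rewrite expectZ // ha hb -EFinM -EFinD.
split.
  rewrite (@expect_fill K q _ (fun t => etot o t + eturn o t) 2 o) //.
  - transitivity (expect K (shiftq q) (fun t => etot o t +
      (eturn o t + 2 * odds (q 1%N) * etot o t))).
      by apply: eq_expect => s _; rewrite /etot; ring.
    rewrite expectD // => [|s]; last by rewrite addr_ge0 // mulr_ge0.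
    by rewrite ha hbb -EFinD.
  - by move=> t; rewrite addr_ge0.
  - move=> t ns _ hs; rewrite /etot /eturn.
    have := @tot_fill o empty t ns hs erefl => ->.
    rewrite -[2]/(2%:R) -natrM -!natrD; congr (_%:R).
    by rewrite /lift upper_empty; lia.
rewrite (@expect_fill K q _ (eturn o) 2 o) //.
- by rewrite -hbb; apply: eq_expect => s _; rewrite /etot; ring.
- move=> t ns _ hs; rewrite /eturn.
  have := @turn_fill o empty t ns hs erefl => ->.
  by rewrite -[2]/(2%:R) -natrM -!natrD; congr (_%:R); rewrite upper_empty; lia.
Qed.

(* Mean length and mean number of turns of an excursion without solitons of
   size larger than K. *)
Fixpoint moments (K : nat) (q : nat -> R) : R * R :=
  if K is K'.+1 then
    let: (u, v) := moments K' (shiftq q) in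
    (u + (v + 2 * odds (q 1%N) * u), v + 2 * odds (q 1%N) * u)
  else (1, 0).

Lemma expect_site K q : unit_weights q ->
  expect K q (etot site_obs) = (moments K q).1%:E /\
  expect K q (eturn site_obs) = (moments K q).2%:E.
Proof.
elim: K q => [|K IH] q hq.
  have lE : [set s | level 0 s] = [set [::]] by apply/seteqP; split => s /eqP.
  by rewrite /expect lE !esum_set1 /wt ?big_geq ?lee_fin //
     /etot /eturn /= ?addn0 ?mul1r ?mulr0.
have [ha hb] := IH _ (unit_weights_shift hq).
have [] := expect_lift hq ha hb; rewrite lift_site => -> ->.
by rewrite /=; case: (moments K _).
Qed.

(** A Dyck word has as many 1s as 0s, and half of the turns are from 1 to 0. The first identity is
    solved for the unknown in the extended reals, finiteness coming from [expect_site]. *)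
Lemma expect_seat0 K q : unit_weights q ->
  expect K q (etot (seat_obs 0)) = (((moments K q).1 - 1) / 2)%:E /\
  expect K q (eturn (seat_obs 0)) = ((moments K q).2 / 2)%:E.
Proof.
move=> hq; have [hu ht] := expect_site K hq; split.
  transitivity (2^-1%:E * (2%:E * expect K q (etot (seat_obs 0))))%E.
    by rewrite muleA -EFinM mulVf ?mul1e.
  suff h : (2%:E * expect K q (etot (seat_obs 0)) + 1 = (moments K q).1%:E)%E.
    have -> : (2%:E * expect K q (etot (seat_obs 0)) = ((moments K q).1 - 1)%:E)%E.
      move: h; case: (2%:E * _)%E => [r||] //=; rewrite -EFinD => -[<-].
      by rewrite addrK.
    by rewrite -EFinM mulrC.
  rewrite -hu -(expect1 K hq) -expectZ //.
  rewrite -expectD //; last by move=> s; rewrite mulr_ge0 // ler0n.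
  apply: eq_expect => s /level_dyck[_ h0]; rewrite /etot /= add0n tot_site.
  have := tot_seat0 empty s; rewrite h0 add0r => -[<-].
  by rewrite /site_obs natrD -mul2n natrM addrC.
have -> : (moments K q).2 / 2 = 2^-1 * (moments K q).2 by rewrite mulrC.
rewrite EFinM -ht -expectZ //.
apply: eq_expect => s _; rewrite /eturn.
have := turn_seat0 empty s; rewrite addn0 => ->.
by rewrite -mul2n natrM mulKf.
Qed.

(** Both sides obey the recursion of [expect_lift], and [k] steps lead down to seat 1. For [K <= k]
    the seat of index [k] stays empty, whence [minn]. *)
Lemma expect_seat k K q : unit_weights q ->
  expect K q (etot (seat_obs k)) =
    (((moments K q).1 - (moments (minn k K) q).1) / 2)%:E /\
  expect K q (eturn (seat_obs k)) =
    (((moments K q).2 - (moments (minn k K) q).2) / 2)%:E.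
Proof.
elim: k K q => [|k IH] K q hq.
  by have := expect_seat0 K hq; rewrite min0n /= subr0.
case: K => [|K].
  have lE : [set s | level 0 s] = [set [::]] by apply/seteqP; split => s /eqP.
  by rewrite minn0 !subrr !mul0r /expect lE !esum_set1 ?lee_fin //
     /etot /eturn /= ?mul0n ?mulr0.
have [ha hb] := IH K _ (unit_weights_shift hq).
have [] := expect_lift hq ha hb; rewrite lift_seat => -> ->.
rewrite minnSS /=; case: (moments K _) => u v; case: (moments (minn k K) _) => u' v' /=.
by split; congr EFin; field.
Qed.

End Expectations.

(** * The two-parameter family of weights *)

Section TwoParameters.
Variable R : realType.
Implicit Types (c d : R) (q : nat -> R).

Definition qcd c d (k : nat) : R :=
  c ^+ (k - 1) * d * (1 - c) ^+ 2 / (1 - c ^+ k * d) ^+ 2.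

Lemma exprd_lt1 c d k : 0 <= c < 1 -> 0 <= d < 1 -> c ^+ k * d < 1.
Proof.
move=> /andP[c0 c1] /andP[d0 d1].
have : c ^+ k <= 1 by rewrite exprn_ile1 // ltW.
have : 0 <= c ^+ k by rewrite exprn_ge0.
by move=> h1 h2; nra.
Qed.

Lemma exprd_neq0 c d k : 0 <= c < 1 -> 0 <= d < 1 -> 1 - c ^+ k * d != 0.
Proof. by move=> hc hd; rewrite subr_eq0 gt_eqF // exprd_lt1. Qed.

Lemma qcdB c d k : 0 <= c < 1 -> 0 <= d < 1 ->
  1 - qcd c d k.+1 =
  (1 - c ^+ k * d) * (1 - c ^+ k.+2 * d) / (1 - c ^+ k.+1 * d) ^+ 2.
Proof.
move=> hc hd; rewrite /qcd subn1 /=.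
have := exprd_lt1 k.+1 hc hd; rewrite !exprS => h.
have h0 : 1 - c * c ^+ k * d != 0 by lra.
by field.
Qed.

Lemma qcd_unit c d : 0 <= c < 1 -> 0 <= d < 1 -> unit_weights (qcd c d).
Proof.
move=> hc hd [//|k] _; have := qcdB k hc hd.
have h0 := exprd_lt1 k hc hd; have h1 := exprd_lt1 k.+1 hc hd.
have h2 := exprd_lt1 k.+2 hc hd => e; apply/andP; split.
  move: hc hd => /andP[c0 c1] /andP[d0 d1].
  by rewrite /qcd !mulr_ge0 ?invr_ge0 ?exprn_ge0 // subr_ge0 ltW.
by rewrite -subr_gt0 e !mulr_gt0 ?invr_gt0 ?exprn_gt0 // subr_gt0.
Qed.

Lemma qcd_summable c d : 0 <= c < 1 -> 0 <= d < 1 ->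
  cvgn (series (fun k : nat => k%:R * qcd c d k)).
Proof.
move=> hc hd; have hu := qcd_unit hc hd.
have := hc => /andP[c0 c1]; have := hd => /andP[d0 d1].
have q0 k : 0 <= k%:R * qcd c d k.
  case: k => [|k]; first by rewrite mul0r.
  by rewrite mulr_ge0 //; case/andP: (hu k.+1 isT).
have nd : nondecreasing_seq (series (fun k : nat => k%:R * qcd c d k)).
  by apply: nondecreasing_series.
apply: nondecreasing_is_cvgn => //.
have hb : cvgn (series (fun n => n%:R * c ^+ n) + series (fun n => c ^+ n)).
  apply: is_cvgD; first exact: is_cvg_nat_geometric.
  have := @is_cvg_geometric_series R 1 c; rewrite ger0_norm // => /(_ c1).
  by rewrite /geometric /=; under [X in series X]eq_fun do rewrite mul1r.
have ndb : nondecreasing_seq (series (fun n => n%:R * c ^+ n) + series (fun n => c ^+ n)).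
  move=> m n mn; apply: lerD; apply: nondecreasing_series => // i _ _.
    by rewrite mulr_ge0 // exprn_ge0.
  by rewrite exprn_ge0.
pose M := limn (series (fun n => n%:R * c ^+ n) + series (fun n => c ^+ n)).
(* Since [1 - c ^+ k.+1 * d >= 1 - d], the term of index [k.+1] is at most this constant times
   [k.+1%:R * c ^+ k], and [M] sums the latter. *)
exists (d * (1 - c) ^+ 2 / (1 - d) ^+ 2 * M) => _ [n _ <-].
apply: le_trans (nd n n.+1 (leqnSn n)) _.
rewrite /series /= big_nat_recl // mul0r add0r.
have C0 : 0 <= d * (1 - c) ^+ 2 / (1 - d) ^+ 2.
  by rewrite !mulr_ge0 ?invr_ge0 ?exprn_ge0 // subr_ge0 ltW.
apply: le_trans (ler_wpM2l C0 (nondecreasing_cvgn_le ndb hb n)).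
have -> : (series (fun n => n%:R * c ^+ n) + series (fun n => c ^+ n)) n =
    \sum_(0 <= i < n) (i.+1%:R * c ^+ i).
  transitivity (\sum_(0 <= i < n) i%:R * c ^+ i + \sum_(0 <= i < n) c ^+ i) => //.
  by rewrite -big_split; apply: eq_bigr => i _; rewrite -natr1 /=; ring.
rewrite mulr_sumr; apply: ler_sum => i _.
have hdi : 0 < 1 - d by rewrite subr_gt0.
rewrite [leRHS]mulrC /qcd subn1 /= -!mulrA ler_wpM2l // ler_wpM2l ?exprn_ge0 //.
rewrite ler_wpM2l // !ler_wpM2l ?subr_ge0 ?(ltW c1) //.
rewrite lef_pV2 ?posrE ?exprn_gt0 // ?subr_gt0 ?exprd_lt1 //.
rewrite lerXn2r ?nnegrE ?subr_ge0 ?(ltW (exprd_lt1 _ hc hd)) ?(ltW d1) //.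
by rewrite lerB // ler_piMl // exprn_ile1 // ltW.
Qed.

Lemma prod_qcd c d K n : 0 <= c < 1 -> 0 <= d < 1 -> (K <= n)%N ->
  \prod_(K <= k < n) (1 - qcd c d k.+1) =
  (1 - c ^+ K * d) / (1 - c ^+ K.+1 * d) *
  ((1 - c ^+ n.+1 * d) / (1 - c ^+ n * d)).
Proof.
move=> hc hd /subnKC <-; elim: (n - K)%N => [|m IH].
  rewrite addn0 big_geq //.
  by field; rewrite !exprd_neq0.
rewrite addnS big_nat_recr ?leq_addr //= IH qcdB //.
by field; rewrite !exprd_neq0.
Qed.

(* First component of moments n, with x = c ^+ n. *)
Definition mu c d (x n : R) : R :=
  (1 + d) / (1 - d) * ((1 + c * x * d) / (1 - c * x * d)
   - 2 * x * d * (1 - c) / ((1 - x * d) * (1 - c * x * d))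
     * (n + (1 + c) * (1 - d) / ((1 - c) * (1 + d)))).

(* Equals mu c (c * d) (c ^+ n.-1) n.-1%:R, without division by c. *)
Definition mu_prev c d (x n : R) : R :=
  (1 + c * d) / (1 - c * d) * ((1 + c * x * d) / (1 - c * x * d)
   - 2 * x * d * (1 - c) / ((1 - x * d) * (1 - c * x * d))
     * (n - 1 + (1 + c) * (1 - c * d) / ((1 - c) * (1 + c * d)))).

(** By the recursion, the second moment is the increment of the first over its value for the shifted
    weights at level [K - 1], which is [mu_prev]. For [K = 0] both [mu] and [mu_prev] equal 1. *)
Lemma moments_qcd c d K q : 0 <= c < 1 -> 0 <= d < 1 ->
  (forall k, (0 < k)%N -> q k = qcd c d k) ->
  moments K q = (mu c d (c ^+ K) K%:R,
                 mu c d (c ^+ K) K%:R - mu_prev c d (c ^+ K) K%:R).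
Proof.
elim: K d q => [|K IH] d q hc hd hq;
  have := hc => /andP[c0 c1]; have := hd => /andP[d0 d1].
  have cd1 : c * d < 1 by nra.
  have cd0 : 0 <= c * d by nra.
  rewrite /= /mu /mu_prev; congr pair; field; rewrite ?gt_eqF //; lra.
have cd1 : c * d < 1 by nra.
have cd0 : 0 <= c * d by nra.
have hcd : 0 <= c * d < 1 by rewrite cd0.
rewrite [moments _ _]/= (IH (c * d)) //; last first.
  move=> [//|k] _; rewrite /shiftq hq // /qcd !subn1 /=.
  by rewrite ![c ^+ _.+1]exprS; congr (_ / _); ring.
have -> : mu_prev c d (c ^+ K.+1) K.+1%:R = mu c (c * d) (c ^+ K) K%:R.
  rewrite /mu_prev /mu -[K.+1%:R]natr1 exprS addrK; set x := c ^+ K.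
  have -> : c * (c * x) * d = c * x * (c * d) by ring.
  have -> : c * x * d = x * (c * d) by ring.
  by have -> : 2 * (c * x) * d = 2 * x * (c * d) by ring.
suff h : mu c (c * d) (c ^+ K) K%:R - mu_prev c (c * d) (c ^+ K) K%:R +
   2 * odds (q 1%N) * mu c (c * d) (c ^+ K) K%:R =
   mu c d (c ^+ K.+1) K.+1%:R - mu c (c * d) (c ^+ K) K%:R.
  by rewrite h addrC subrK.
have h0 : c ^+ K * (c * d) < 1 by exact: exprd_lt1.
have h1 := exprd_lt1 K.+1 hc hcd; rewrite exprS in h1.
have ccd : c * (c * d) < 1 by nra.
have q1 : odds (q 1%N) = d * (1 - c) ^+ 2 / ((1 - d) * (1 - c * (c * d))).
  rewrite /odds hq // qcdB // /qcd expr0 !exprS expr0; field.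
  by rewrite ?gt_eqF //; lra.
rewrite q1 /mu /mu_prev -[K.+1%:R]natr1 [c ^+ K.+1]exprS.
move: h0 h1; set x := c ^+ K => h0 h1.
have ccd0 : 0 <= c * (c * d) by nra.
field; rewrite ?gt_eqF //=; lra.
Qed.

Lemma mu_cvg c d : 0 <= c < 1 -> 0 <= d < 1 ->
  (fun K : nat => mu c d (c ^+ K) K%:R) @ \oo --> (1 + d) / (1 - d).
Proof.
move=> hc hd; have := hc => /andP[c0 c1]; have := hd => /andP[d0 d1].
(* The limit is written in the shape of the sequence, with 0 in place of [c ^+ K] and of
   [K%:R * c ^+ K]. *)
have e : (1 + d) / (1 - d) = (1 + d) / (1 - d) * ((1 + c * 0 * d) / (1 - c * 0 * d)
   - (2 * d * (1 - c) / ((1 - 0 * d) * (1 - c * 0 * d)))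
     * (0 + 0 * ((1 + c) * (1 - d) / ((1 - c) * (1 + d))))).
  by rewrite !mulr0 !mul0r !addr0 !subr0 !mulr0 subr0 divr1 mulr1.
rewrite {}e; rewrite (_ : (fun K : nat => _) = (fun K : nat => (1 + d) / (1 - d) *
   ((1 + c * c ^+ K * d) / (1 - c * c ^+ K * d)
   - (2 * d * (1 - c) / ((1 - c ^+ K * d) * (1 - c * c ^+ K * d)))
     * (K%:R * c ^+ K + c ^+ K * ((1 + c) * (1 - d) / ((1 - c) * (1 + d))))))); last first.
  apply/funext => K; rewrite /mu.
  have h0 := exprd_lt1 K hc hd; have h1 := exprd_lt1 K.+1 hc hd; rewrite exprS in h1.
  by field; rewrite ?gt_eqF //=; lra.
have x0 := cvg_expr_0 hc; have nx0 := cvg_nat_expr hc.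
have cst (a : R) : (fun _ : nat => a) @ \oo --> a by exact: cvg_cst.
have cx : (fun K => c * c ^+ K * d) @ \oo --> c * 0 * d.
  by apply: cvgM => //; apply: cvgM.
have xd : (fun K => c ^+ K * d) @ \oo --> 0 * d by apply: cvgM.
apply: cvgM => //; apply: cvgB; apply: cvgM.
- exact: cvgD.
- by apply: cvgV; [rewrite mulr0 mul0r subr0 oner_eq0|exact: cvgB].
- apply: cvgM => //; apply: cvgV; last by apply: cvgM; exact: cvgB.
  by rewrite mulr0 !mul0r subr0 mulr1 oner_eq0.
- by apply: cvgD => //; apply: cvgM.
Qed.

(** Serves twice: as the factor of [prod_qcd] that depends on [n], and, inverted, as the value of
    the product from [K] on, when [K] grows. *)
Lemma cvg_tail c d : 0 <= c < 1 -> 0 <= d < 1 ->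
  (fun n : nat => (1 - c ^+ n.+1 * d) / (1 - c ^+ n * d)) @ \oo --> (1 : R).
Proof.
move=> hc hd.
have x0 := cvg_expr_0 hc.
have cst (a : R) : (fun _ : nat => a) @ \oo --> a by exact: cvg_cst.
have e : (1 : R) = (1 - c * 0 * d) / (1 - 0 * d).
  by rewrite mulr0 mul0r !subr0 divr1.
rewrite [X in _ --> X]e (_ : (fun n => _) = (fun n => (1 - c * c ^+ n * d) / (1 - c ^+ n * d))).
  apply: cvgM; first by apply: cvgB => //; apply: cvgM => //; apply: cvgM.
  apply: cvgV; first by rewrite mul0r subr0 oner_eq0.
  by apply: cvgB => //; apply: cvgM.
by apply/funext => n; rewrite exprS.
Qed.

End TwoParameters.

(** * Records and seats of configurations *)

Lemma fsbig_itv (R : Type) (idx : R) (op : Monoid.com_law idx) (n : nat)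
    (a : int) (F : int -> R) :
  \big[op/idx]_(y \in `[a, a + n%:Z[) F y =
  \big[op/idx]_(0 <= i < n) F (a + i%:Z).
Proof.
rewrite big_mkord (@fsbig_ord R idx op n (fun i => F (a + i%:Z))); apply: reindex_fsbig; split.
- by move=> i /= hi; rewrite in_itv /=; lia.
- by move=> i j _ _ /addrI [].
- move=> y /=; rewrite in_itv /= => /andP[h1 h2].
  by exists `|y - a|%N; rewrite /=; lia.
Qed.

Lemma fsbig_itv_oc (R : Type) (idx : R) (op : Monoid.com_law idx) (n : nat)
    (a : int) (F : int -> R) :
  \big[op/idx]_(y \in `]a, a + n%:Z]) F y =
  \big[op/idx]_(0 <= i < n) F (a + i.+1%:Z).
Proof.
rewrite (_ : [set` `]a, a + n%:Z]] = [set` `[a + 1, a + 1 + n%:Z[]); last first.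
  by apply/seteqP; split => y /=; rewrite !in_itv /=; lia.
by rewrite fsbig_itv; apply: eq_bigr => i _; congr F; lia.
Qed.

Definition word (eta : int -> bool) (a : int) (n : nat) : seq bool :=
  mkseq (fun i => eta (a + i%:Z)) n.

Lemma size_word eta a n : size (word eta a n) = n.
Proof. exact: size_mkseq. Qed.

Lemma word_add eta a m n :
  word eta a (m + n) = word eta a m ++ word eta (a + m%:Z) n.
Proof.
rewrite /word /mkseq iotaD map_cat; congr (_ ++ _).
rewrite add0n -[X in iota X]addn0 iotaDl -map_comp.
by apply: eq_map => i /=; congr eta; lia.
Qed.

Lemma wordSr eta a n : word eta a n.+1 = rcons (word eta a n) (eta (a + n%:Z)).
Proof. by rewrite -addn1 word_add cats1 addr0. Qed.

Lemma word_shift y eta a n : word (Defs.shift y eta) a n = word eta (a + y) n.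
Proof. by apply: eq_map => i; rewrite /Defs.shift addrAC. Qed.

Lemma take_word eta a m n : (m <= n)%N -> take m (word eta a n) = word eta a m.
Proof.
by move=> /subnKC <-; rewrite word_add take_size_cat // size_word.
Qed.

Lemma drop_word eta a m n :
  drop m (word eta a (m + n)) = word eta (a + m%:Z) n.
Proof. by rewrite word_add drop_size_cat // size_word. Qed.

Lemma hgt_word eta a n :
  hgt (word eta a n) = \sum_(0 <= i < n) (2 * (eta (a + i%:Z))%:R - 1).
Proof. by rewrite /hgt big_map /index_iota subn0. Qed.

Lemma is_recordP eta x :
  is_record eta x <-> forall n : nat, hgt (word eta (x - n%:Z) n.+1) < 0.
Proof.
have e n : \sum_(y \in `[x - n%:Z, x]) (2 * (eta y)%:R - 1 : int) =
    hgt (word eta (x - n%:Z) n.+1).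
  rewrite (_ : [set` `[x - n%:Z, x]] = [set` `[x - n%:Z, x - n%:Z + n.+1%:Z[]).
    by rewrite fsbig_itv hgt_word.
  by apply/seteqP; split => y /=; rewrite !in_itv /=; lia.
split=> [h n|h z zx]; first by rewrite -e; apply: h; lia.
by have := h `|x - z|%N; rewrite -e (_ : x - _ = z) //; lia.
Qed.

Lemma is_record_shift y eta x :
  is_record (Defs.shift y eta) x <-> is_record eta (x + y).
Proof.
rewrite !is_recordP; split=> h n; have := h n;
by rewrite word_shift (_ : x - n%:Z + y = x + y - n%:Z) //; lia.
Qed.

Lemma run_record eta r n : is_record eta (r + n%:Z) ->
  run empty (word eta (r + 1) n) = empty.
Proof.
move=> /is_recordP h; apply: run_suffix_lt0 => m; rewrite size_word => mn.
rewrite -(subnKC (ltnW mn)) drop_word.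
have := h (n - m).-1; rewrite prednK ?subn_gt0 //.
by rewrite (_ : r + n%:Z - _ = r + 1 + m%:Z) //; lia.
Qed.

Lemma run_record_eq eta r n m : is_record eta (r + n%:Z) ->
  run empty (word eta (r + 1) (n + m)) =
  run empty (word eta (r + n%:Z + 1) m).
Proof.
by move=> h; rewrite word_add run_cat run_record // addrAC.
Qed.

(** An explicit stand-in for [seat], built from countably many events on finite words, hence
    measurable. *)
Definition seatR (eta : int -> bool) (x : int) (k : nat) : bool :=
  `[< exists n : nat, is_record eta (x - n%:Z) /\
        run empty (word eta (x - n%:Z + 1) n) k >].

(** The starting record does not matter, as reading up to a later record leaves all seats empty. *)
Lemma seatRE eta r n k : is_record eta r ->
  seatR eta (r + n%:Z) k = run empty (word eta (r + 1) n) k.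
Proof.
move=> hr; apply/asboolP/idP => [[m [hm]]|h]; last first.
  by exists n; rewrite addrK.
have [mn|nm] := leqP m n.
  rewrite -{2}(subnK mn) run_record_eq; last by rewrite (_ : _ + _ = r + n%:Z - m%:Z) //; lia.
  by rewrite (_ : r + (n - m)%N%:Z = r + n%:Z - m%:Z) //; lia.
rewrite -{2}(subnK (ltnW nm)) run_record_eq; last first.
  by rewrite (_ : r + n%:Z - m%:Z + (m - n)%N%:Z = r) //; lia.
by rewrite (_ : r + n%:Z - m%:Z + (m - n)%N%:Z = r) //; lia.
Qed.

Definition unbounded_below (P : int -> Prop) := forall x, exists2 r, r <= x & P r.
Definition unbounded_above (P : int -> Prop) := forall x, exists2 r, x <= r & P r.

Lemma prod_bool (f : nat -> bool) k :
  \prod_(1 <= j < k.+1) (f j)%:R = (all (fun j => f j.+1) (iota 0 k))%:R :> int.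
Proof.
rewrite big_add1 /=; elim: k => [|k IH]; first by rewrite big_geq.
rewrite big_nat_recr // IH (_ : iota 0 k.+1 = iota 0 k ++ [:: k]); last first.
  by rewrite -addn1 iotaD.
rewrite all_cat /= andbT.
by case: (all _ _); case: (f _); rewrite ?mul0r ?mulr0 ?mulr1.
Qed.

Lemma upE eta W k x :
  up eta W k.+1 x =
  (~~ W k.+1 (x - 1) && step (eta x) (fun j => W j.+1 (x - 1)) k)%:R.
Proof.
rewrite /up prod_bool /step; case: (eta x); rewrite ?mul0r ?mul1r.
  under [X in if X then _ else _]eq_all do rewrite eqb_id.
  by case: (W k.+1 _) => /=; rewrite ?subrr ?mul0r // subr0 mul1r; case: (all _ _).
by case: (W k.+1 _) => //=; case: ifP.
Qed.

Lemma downE eta W k x :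
  Defs.down eta W k.+1 x =
  (W k.+1 (x - 1) && ~~ step (eta x) (fun j => W j.+1 (x - 1)) k)%:R.
Proof.
rewrite /Defs.down /step.
have -> : \prod_(1 <= j < k.+1) (1 - (W j (x - 1))%:R) =
    \prod_(1 <= j < k.+1) (~~ W j (x - 1))%:R :> int.
  by apply: eq_bigr => j _; case: (W j _).
rewrite prod_bool; case: (eta x); rewrite ?subrr ?mul0r ?subr0 ?mul1r.
  by case: (W k.+1 _) => //=; case: ifP.
under [X in if X then _ else _]eq_all do rewrite eqbF_neg.
by case: (W k.+1 _) => /=; rewrite ?mul0r // mul1r; case: (all _ _).
Qed.

Lemma is_seatP eta W : is_seat eta W <->
  (forall k x, is_record eta x -> W k.+1 x = false) /\
  (forall k x, W k.+1 x = step (eta x) (fun j => W j.+1 (x - 1)) k).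
Proof.
have e (a b : bool) : (a%:R : int) + (~~ a && b)%:R - (a && ~~ b)%:R = b%:R.
  by case: a; case: b.
have inj (a b : bool) : a%:R = b%:R :> int -> a = b by case: a; case: b.
split=> [h|[h1 h2] [//|k] _].
  split=> k x; first by case: (h k.+1 isT) => + _; exact.
  by case: (h k.+1 isT) => _ /(_ x); rewrite upE downE e => /inj.
by split=> x; [exact: h1|rewrite upE downE e h2].
Qed.

Lemma is_seat_run eta W r n : is_seat eta W -> is_record eta r ->
  (fun k => W k.+1 (r + n%:Z)) = run empty (word eta (r + 1) n).
Proof.
move=> /is_seatP[h1 h2] hr; elim: n => [|n IH].
  by apply/funext => k; rewrite addr0 h1.
rewrite wordSr -cats1 run_cat -IH /=; apply/funext => k.
have e1 : r + n.+1%:Z - 1 = r + n%:Z by lia.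
have e2 : r + n.+1%:Z = r + 1 + n%:Z by lia.
by rewrite h2 e1 e2.
Qed.

Lemma unbounded_below_nat P x : unbounded_below P ->
  exists r (n : nat), P r /\ x = r + n%:Z.
Proof.
by move=> /(_ x)[r rx Pr]; exists r, `|x - r|%N; split => //; lia.
Qed.

Lemma seat_is_seat eta : unbounded_below (is_record eta) ->
  is_seat eta (seat eta).
Proof.
move=> hb; apply: getPex.
exists (fun k x => if k is k'.+1 then seatR eta x k' else false).
apply/is_seatP; split => k x.
  by move=> hx; have := seatRE 0 k hx; rewrite addr0.
have [r [n [hr e]]] := unbounded_below_nat (x - 1) hb.
have -> : (fun j => seatR eta (x - 1) j) = run empty (word eta (r + 1) n).
  by apply/funext => j; rewrite e seatRE.
have xE : x = r + n.+1%:Z by lia.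
rewrite {1}xE seatRE // wordSr -cats1 run_cat /=.
by rewrite (_ : r + 1 + n%:Z = x) //; lia.
Qed.

Lemma seat_run eta r n : unbounded_below (is_record eta) -> is_record eta r ->
  (fun k => seat eta k.+1 (r + n%:Z)) = run empty (word eta (r + 1) n).
Proof. by move=> hb hr; apply: is_seat_run => //; exact: seat_is_seat. Qed.

Lemma seatE eta k x : unbounded_below (is_record eta) ->
  seat eta k.+1 x = seatR eta x k.
Proof.
move=> hb; have [r [n [hr ->]]] := unbounded_below_nat x hb.
by rewrite seatRE // -seat_run.
Qed.

(** A letter changes at most one seat, the first whose content differs from it. *)
Lemma sum_step b w k :
  \sum_(0 <= j < k) (step b w j != w j : nat) =
  ~~ all (fun j => w j == b) (iota 0 k).
Proof.
elim: k => [|k IH]; first by rewrite big_geq.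
rewrite big_nat_recr // IH (_ : iota 0 k.+1 = iota 0 k ++ [:: k]); last first.
  by rewrite -addn1 iotaD.
rewrite all_cat /= andbT /step.
by case: (all _ _) => /=; rewrite ?eqxx //= eq_sym.
Qed.

Lemma sum_updown eta k x : unbounded_below (is_record eta) ->
  \sum_(1 <= j < k.+1) (eta_up eta j x + eta_down eta j x) =
  (~~ all (fun j => seat eta j.+1 (x - 1) == eta x) (iota 0 k))%:R.
Proof.
move=> hb; rewrite big_add1 /=.
rewrite -(sum_step (eta x) (fun j => seat eta j.+1 (x - 1))) natr_sum.
apply: eq_bigr => j _; rewrite /eta_up /eta_down upE downE -natrD.
by congr (_%:R); case: (seat _ _ _); case: (step _ _ _).
Qed.

(** * Enumerating the records *)

Section IncreasingFunctions.
Variable s : int -> int.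
Hypothesis sS : forall i, s i < s (i + 1).

Lemma incr_lt (i j : int) : i < j -> s i < s j.
Proof.
move=> ij; rewrite (_ : j = i + (absz (j - i - 1)%R).+1%:Z); last by lia.
elim: (absz _) => [|n IH]; first exact: sS.
by apply: lt_trans IH _; have := sS (i + n.+1%:Z); rewrite -addrA -PoszD addn1.
Qed.

Lemma incr_gap (i : int) (n : nat) : s i + n%:Z <= s (i + n%:Z).
Proof.
elim: n => [|n IH]; first by rewrite !addr0.
have h : i + n.+1%:Z = i + n%:Z + 1 by lia.
by have := sS (i + n%:Z); rewrite -h; lia.
Qed.

Lemma incr_surround (x : int) : exists i, s i <= x < s (i + 1).
Proof.
(* [s] grows by at least 1 per step, so going back by the distance from [s 0] to [x] reaches a value
   at most [x]. *)
pose i0 : int := - (absz (s 0 - x)%R)%:Z.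
have h0 : s i0 <= x.
  have := incr_gap i0 (absz (s 0 - x)%R).
  by rewrite (_ : i0 + _ = 0) /i0; lia.
have ex : exists n : nat, x < s (i0 + n%:Z).
  by exists (absz (x + 1 - s i0)%R); have := incr_gap i0 (absz (x + 1 - s i0)%R); lia.
case: (ex_minnP ex) => -[|n] hn hmin; first by move: hn; rewrite addr0; lia.
exists (i0 + n%:Z); rewrite -addrA -PoszD addn1 hn andbT leNgt.
by apply/negP => /hmin; rewrite ltnn.
Qed.

End IncreasingFunctions.

Section RecordEnumeration.
Variable eta : int -> bool.

Lemma next_of (P : int -> Prop) (x : int) : unbounded_above P ->
  exists y, [/\ x < y, P y & forall z, P z -> x < z -> y <= z].
Proof.
move=> /(_ (x + 1))[r xr Pr].
have ex : exists n : nat, `[< P (x + 1 + n%:Z) >].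
  by exists (absz (r - x - 1)%R); apply/asboolP; rewrite (_ : x + 1 + _ = r) //; lia.
case: (ex_minnP ex) => n /asboolP hn hmin; exists (x + 1 + n%:Z); split=> //; first by lia.
move=> z Pz xz; have := hmin (absz (z - x - 1)%R).
rewrite (_ : x + 1 + _ = z); last by lia.
by move=> /(_ (asboolT Pz)); lia.
Qed.

Lemma prev_of (P : int -> Prop) (x : int) : unbounded_below P ->
  exists y, [/\ y < x, P y & forall z, P z -> z < x -> z <= y].
Proof.
move=> hb; have [|y [h1 h2 h3]] := @next_of (fun y => P (- y)) (- x).
  by move=> z; have [r rz Pr] := hb (- z); exists (- r); rewrite ?opprK //; lia.
exists (- y); split => //; first by lia.
by move=> z Pz zx; have := h3 (- z); rewrite opprK => /(_ Pz); lia.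
Qed.

Lemma record_enum_exists :
  unbounded_below (is_record eta) -> unbounded_above (is_record eta) ->
  exists2 t : int -> int, (forall i, t i < t (i + 1)) &
    is_record_enum eta (fun i => (t i)%:E).
Proof.
move=> hb ha.
have [nx nxP] := choice (fun x => next_of x ha).
have [pv pvP] := choice (fun x => prev_of x hb).
pose x0 := pv 1.
pose t (i : int) := match i with Posz n => iter n nx x0 | Negz n => iter n.+1 pv x0 end.
have tR i : is_record eta (t i).
  by case: i => [[|n]|n] /=; [case: (pvP 1)|case: (nxP (iter n nx x0))|case: (pvP (iter n pv x0))].
have nxpv x : is_record eta x -> nx (pv x) = x.
  move=> hx; have [a1 a2 a3] := pvP x; have [b1 b2 b3] := nxP (pv x).
  apply/eqP; rewrite eq_le b3 //=; rewrite leNgt; apply/negP => h.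
  by have := a3 _ b2 h; lia.
have tS i : t (i + 1) = nx (t i).
  case: i => [n|[|n]].
  - by rewrite -PoszD addn1.
  - by rewrite /= nxpv //; case: (pvP 1).
  - have -> : Negz n.+1 + 1 = Negz n by lia.
    by rewrite /= nxpv //; exact: (tR (Negz n)).
have tlt i : t i < t (i + 1) by rewrite tS; case: (nxP (t i)).
exists t => //; split.
- by move=> i j ij; left; rewrite lte_fin; exact: incr_lt.
- move=> x; split=> [hx|[i [<-]]]; last exact: tR.
  have [i /andP[h1 h2]] := incr_surround tlt x; exists i; congr EFin.
  apply/eqP; rewrite eq_le h1 /= leNgt; apply/negP => h.
  by move: h2; rewrite tS; have [_ _ /(_ x hx h)] := nxP (t i); lia.
by exists x0; have [h1 h2 h3] := pvP 1; split.
Qed.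

(** A value [+oo] would first occur at a positive index, and no record could exceed the value just
    before it. The value [-oo] is excluded because the preceding one would be strictly smaller. *)
Lemma record_enum_fin s :
  unbounded_below (is_record eta) -> unbounded_above (is_record eta) ->
  is_record_enum eta s -> forall i, s i \is a fin_num.
Proof.
move=> hb ha [h1 h2 [x0 [s0 x00 hx0]]] i.
have [si|si] := boolP (s i == +oo%E); last first.
  rewrite fin_numE si andbT; apply/eqP => e.
  have im : i - 1 < i by lia.
  case: (h1 _ _ im); rewrite e; last by case.
  by rewrite ltNge leNye.
exfalso; have {si} si : s i = +oo%E by apply/eqP.
have i0 : i > 0.
  rewrite ltNge; apply/negP => i0.
  have [i00|i00] := eqVneq i 0; first by move: si; rewrite i00 s0.
  have i1 : i < 0 by lia.
  by case: (h1 _ _ i1) => [|[]]; rewrite si s0.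
have ex : exists n : nat, s n%:Z == +oo%E.
  by exists (absz i); rewrite (_ : Posz _ = i) ?si //; lia.
case: (ex_minnP ex) => -[|m] /eqP hm hmin; first by move: hm; rewrite s0.
have : s m%:Z != +oo%E by apply/eqP => /eqP/hmin; rewrite ltnn.
case em : (s m%:Z) => [y||] // _; last first.
  have [m0|m0] := posnP m; first by move: em; rewrite m0 s0.
  have m1 : (0 : int) < m%:Z by lia.
  by case: (h1 _ _ m1) => [|[]]; rewrite em s0.
have [r yr rR] := ha (y + 1).
have [j ej] := (h2 r).1 rR.
have [jm|mj] := leP j m%:Z.
  have [jm1|jm1] := eqVneq j m%:Z; first by move: ej; rewrite jm1 em => -[]; lia.
  have jm2 : j < m%:Z by lia.
  by case: (h1 _ _ jm2) => [|[]]; rewrite ej em // lte_fin; lia.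
have [jm1|jm1] := eqVneq j m.+1%:Z; first by move: ej; rewrite jm1 hm.
have jm2 : m.+1%:Z < j by lia.
by case: (h1 _ _ jm2) => [|[]]; rewrite ?ej // hm ltNge leey.
Qed.

Lemma s_inf_enum :
  unbounded_below (is_record eta) -> unbounded_above (is_record eta) ->
  is_record_enum eta (s_inf eta) /\ forall i, s_inf eta i \is a fin_num.
Proof.
move=> hb ha; have h : is_record_enum eta (s_inf eta).
  by apply: xgetPex; have [t _ ht] := record_enum_exists hb ha; exists (fun i => (t i)%:E).
by split => //; exact: record_enum_fin.
Qed.

Lemma s_inf_finP : (forall i, s_inf eta i \is a fin_num) <->
  unbounded_below (is_record eta) /\ unbounded_above (is_record eta).
Proof.
split=> [hf|[hb ha]]; last by case: (s_inf_enum hb ha).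
have [h1 h2 _] : is_record_enum eta (s_inf eta).
  (* The default of [xget] is infinite, so finite values mean that an enumeration was found. *)
  move: hf; rewrite /s_inf; case: xgetP => [s _ //|_ /(_ 0)].
  by rewrite fin_numE.
pose t i := fine (s_inf eta i).
have tE i : s_inf eta i = (t i)%:E by rewrite fineK.
have tS i : t i < t (i + 1).
  have ii : i < i + 1 by lia.
  by case: (h1 _ _ ii); rewrite !tE ?lte_fin // => -[].
have tR i : is_record eta (t i) by apply/h2; exists i.
split=> x.
  by have [i /andP[hi _]] := incr_surround tS x; exists (t i).
by have [i /andP[_ hi]] := incr_surround tS x; exists (t (i + 1)) => //; exact: ltW.
Qed.

Lemma s_inf0 :
  unbounded_below (is_record eta) -> unbounded_above (is_record eta) ->
  is_record eta 0 <-> s_inf eta 0 = 0%:E.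
Proof.
move=> hb ha; have [[h1 h2 [x0 [e x00 hx]]] _] := s_inf_enum hb ha.
split=> [h0|h0]; last by apply/h2; exists 0.
by rewrite e; congr EFin; have := hx 0 h0; lia.
Qed.

Lemma s_inf1 : unbounded_below (is_record eta) ->
  unbounded_above (is_record eta) -> is_record eta 0 ->
  exists n : nat, [/\ s_inf eta 1 = n.+1%:Z%:E, is_record eta n.+1%:Z &
    forall y : nat, (0 < y <= n)%N -> ~ is_record eta y%:Z].
Proof.
move=> hb ha h0; have [[h1 h2 h3] hf] := s_inf_enum hb ha.
have e0 := (s_inf0 hb ha).1 h0.
have [x ex] : exists x, s_inf eta 1 = x%:E by exists (fine (s_inf eta 1)); rewrite fineK.
have x0 : 0 < x.
  by case: (h1 0 1 ltr01); rewrite e0 ex ?lte_fin // => -[].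
exists (absz x).-1%N; rewrite (_ : Posz _ = x); last by lia.
split => //; first by apply/h2; exists 1.
move=> y hy /h2[i ei].
have [i1|i1] := leP 1 i.
  have [ii|ii] := eqVneq i 1; first by move: ei; rewrite ii ex => -[]; lia.
  have i2 : 1 < i by lia.
  by case: (h1 _ _ i2) => [|[]]; rewrite ei ex ?lte_fin //; lia.
have [ii|ii] := eqVneq i 0; first by move: ei; rewrite ii e0 => -[]; lia.
have i2 : i < 0 by lia.
by case: (h1 _ _ i2) => [|[]]; rewrite ei e0 ?lte_fin //; lia.
Qed.

End RecordEnumeration.

Lemma Omega_rP (R : realType) eta : Omega_r R eta <->
  [/\ Omega R eta, unbounded_below (is_record eta),
      unbounded_above (is_record eta) & is_record eta 0].
Proof.
split=> [[[hO /s_inf_finP[hb ha]] h0]|[hO hb ha h0]].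
  by split => //; apply/s_inf0.
by split; [split => //; apply/s_inf_finP|apply/s_inf0].
Qed.

(** * Soliton counts of an excursion *)

Fixpoint fills (k : nat) (w : nat -> bool) (s : seq bool) : nat :=
  if s is b :: s' then
    ((~~ w k && step b w k) + fills k (step b w) s')%N
  else 0%N.

Lemma fills_sum k w s : fills k w s =
  (\sum_(0 <= m < size s) (~~ run w (take m s) k &&
     step (nth false s m) (run w (take m s)) k))%N.
Proof.
elim: s w => [|b s IH] w; first by rewrite big_geq.
by rewrite /= big_nat_recl // IH.
Qed.

Lemma fills_upper k w s : fills k.+1 w s = fills k (upper w) (red (w 0%N) s).
Proof.
elim: s w => [//|b s IH] w /=; rewrite IH upper_step step0.
have e : step b w k.+1 = upper (step b w) k by [].
rewrite e upper_step eq_sym; case: eqP => //= _.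
by rewrite /upper andNb add0n.
Qed.

Lemma turn_fills w s : turn (seat_obs 0) w s = (fills 0 w s + w 0%N)%N.
Proof.
elim: s w => [|b s IH] w /=; first by rewrite /seat_obs; case: (w 0%N).
by rewrite IH step0 /seat_obs; case: (w 0%N); case: b; rewrite /=; lia.
Qed.

(** Fillings of the seat of index [k] are those of seat 1 after [k] reductions, and each is matched
    by a turn from 1 to 0. *)
Lemma fills_ups k s : fills k empty s = ups k s.
Proof.
elim: k s => [|k IH] s; first by rewrite /ups turn_fills addn0.
by rewrite fills_upper upper_empty IH /ups iterSr.
Qed.

Definition body (e : excursion) : seq bool := behead (val e).

Lemma walk_take s m : (m <= size s)%N -> walk (false :: s) m = hgt (take m s).
Proof.
move=> ms; rewrite /walk /hgt big_add1 /= (big_nth false) size_take_min (minn_idPl ms).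
by apply: eq_big_nat => i /andP[_ im]; rewrite nth_take.
Qed.

Lemma dyck_even s : dyck s -> ~~ odd (size s).
Proof.
by move=> [_ h]; have := tot_seat0 empty s; rewrite h add0r => -[<-]; rewrite odd_double.
Qed.

Lemma is_excursionP s : is_excursion (false :: s) <-> dyck s.
Proof.
split.
  case/and4P => _ _ /allP ha /eqP h0; rewrite /= in h0.
  rewrite walk_take // take_size in h0; split => // m.
  have [ms|ms] := leqP (size s) m; first by rewrite take_oversize // h0.
  have [->|m0] := posnP m; first by rewrite take0 hgt_nil.
  by rewrite -walk_take ?(ltnW ms) //; apply: ha; rewrite mem_index_iota m0.
move=> ds; have [hp h0] := ds; apply/and4P; split=> //=.
- exact: dyck_even.
- by apply/allP => m; rewrite mem_index_iota => /andP[_ ms]; rewrite walk_take // ltnW.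
- by rewrite walk_take // take_size h0.
Qed.

Lemma excursionE (e : excursion) : val e = false :: body e.
Proof.
by case: e => -[|b s] // h; rewrite /body /=; case/and4P: h => _ /eqP /= ->.
Qed.

Lemma body_dyck e : dyck (body e).
Proof. by apply/is_excursionP; rewrite -excursionE; exact: valP. Qed.

Lemma lenE e : len e = (size (body e)).+1.
Proof. by rewrite /len excursionE. Qed.

Lemma hgt_word_false eta a n :
  (forall i, (i < n)%N -> eta (a + i%:Z) = false) -> hgt (word eta a n) = - n%:Z.
Proof.
move=> h; rewrite hgt_word (eq_big_nat _ _ (F2 := fun=> -1)).
  by rewrite big_const_nat subn0 iter_addr_0; lia.
by move=> i /andP[_ hi]; rewrite h.
Qed.

Lemma hgt_drop_le0 m s : dyck s -> hgt (drop m s) <= 0.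
Proof.
by move=> [hp]; rewrite -{1}(cat_take_drop m s) hgt_cat => h0; have := hp m; lia.
Qed.

(** * The excursion padded with zeros: records and seats *)

Section IotaExcursion.
Variable e : excursion.
Let eta := iota_exc e.
Let s := body e.

Lemma iota_body i : eta (1 + i%:Z) = nth false s i.
Proof. by rewrite (_ : 1 + i%:Z = i.+1%:Z) /eta /= ?excursionE //; lia. Qed.

Lemma iota_le0 (x : int) : x <= 0 -> eta x = false.
Proof. by case: x => [[|n]|n] // _; rewrite /eta /= excursionE. Qed.

Lemma iota_ge (x : int) : (size s).+1%:Z <= x -> eta x = false.
Proof.
case: x => [n|//] hn; rewrite /eta /= nth_default // excursionE /=.
by move: hn; rewrite lez_nat.
Qed.

Lemma word_iota n : (n <= size s)%N -> word eta 1 n = take n s.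
Proof.
move=> hn; apply: (@eq_from_nth _ false); first by rewrite size_word size_takel.
by move=> i; rewrite size_word => hi; rewrite nth_mkseq // iota_body nth_take.
Qed.

Lemma record_iota_le0 (x : int) : x <= 0 -> is_record eta x.
Proof.
move=> x0; apply/is_recordP => n; rewrite hgt_word_false; first by lia.
by move=> i hi; apply: iota_le0; lia.
Qed.

(** Three positions of the left end: beyond the excursion; inside its body, where suffixes of a Dyck
    word have height at most 0; at or before site 0. *)
Lemma record_iota_ge (x : int) : (size s).+1%:Z <= x -> is_record eta x.
Proof.
move=> hx; apply/is_recordP => n.
have hz (j : nat) y : (size s).+1%:Z <= y -> hgt (word eta y j.+1) < 0.
  by move=> hy; rewrite hgt_word_false; [lia|move=> i hi; apply: iota_ge; lia].
have [h1|h1] := leP (size s).+1%:Z (x - n%:Z); first exact: hz.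
have ds : dyck s := body_dyck e.
have hw1 (m : nat) : (0 < m)%N -> (m <= size s)%N ->
    hgt (word eta m%:Z (size s - m).+1) <= 0.
  move=> m0 hm; have := @hgt_drop_le0 m.-1 s ds.
  have sE : s = word eta 1 (m.-1 + (size s - m).+1).
    by rewrite (_ : (_ + _)%N = size s) ?word_iota ?take_size //; lia.
  by rewrite {1}sE drop_word (_ : 1 + m.-1%:Z = m%:Z) //; lia.
have [h2|h2] := leP 1 (x - n%:Z).
  pose m := absz (x - n%:Z); have mE : x - n%:Z = m%:Z by rewrite /m; lia.
  have -> : n.+1 = ((size s - m).+1 + (absz (x - (size s).+1%:Z)%R).+1)%N by lia.
  rewrite word_add hgt_cat mE.
  have := hz (absz (x - (size s).+1%:Z)%R) (m%:Z + (size s - m).+1%:Z).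
  have := hw1 m; lia.
have -> : n.+1 = (absz (1 - (x - n%:Z))%R + (size s +
   (absz (x - (size s).+1%:Z)%R).+1))%N by lia.
rewrite !word_add !hgt_cat hgt_word_false; last by move=> i hi; apply: iota_le0; lia.
rewrite (_ : x - n%:Z + _ = 1); last by lia.
rewrite word_iota // take_size; case: ds => _ ->.
rewrite add0r -[ltRHS]addr0; apply: ler_ltD; first by lia.
by apply: hz; lia.
Qed.

Lemma iota_below : unbounded_below (is_record eta).
Proof. by move=> x; exists (- (absz x)%:Z); [lia|apply: record_iota_le0; lia]. Qed.

Lemma iota_above : unbounded_above (is_record eta).
Proof.
move=> x; exists ((size s).+1%:Z + (absz x)%:Z); first by lia.
by apply: record_iota_ge; lia.
Qed.

Lemma iota_s_inf0 : s_inf eta 0 = 0%:E.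
Proof.
by apply/(s_inf0 iota_below iota_above); apply: record_iota_le0.
Qed.

Lemma seat_iota n : (n <= size s)%N ->
  (fun k => seat eta k.+1 n%:Z) = run empty (take n s).
Proof.
move=> hn; rewrite -word_iota //.
by have := @seat_run eta 0 n iota_below (record_iota_le0 (lexx 0)).
Qed.

Lemma seat_iota_le0 k (x : int) : x <= 0 -> seat eta k.+1 x = false.
Proof.
move=> x0; have [h _] := (is_seatP eta _).1 (seat_is_seat iota_below).
exact/h/record_iota_le0.
Qed.

End IotaExcursion.

Lemma int_primitive (g : int -> int) (x0 : int) :
  exists f : int -> int, f x0 = 0 /\ forall x, f x - f (x - 1) = g x.
Proof.
pose F (x : int) : int := match x with
  | Posz n => \sum_(0 <= i < n) g i.+1%:Z
  | Negz n => - \sum_(0 <= i < n.+1) g (- i%:Z) end.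
have FS x : F x - F (x - 1) = g x.
  case: x => [[|n]|n].
  - by rewrite /F /= big_nat1 big_geq // oppr0 sub0r opprK.
  - rewrite (_ : n.+1%:Z - 1 = n%:Z); last by lia.
    by rewrite /F big_nat_recr //= addrAC subrr add0r.
  - rewrite (_ : Negz n - 1 = Negz n.+1); last by lia.
    by rewrite /F [in X in _ - X]big_nat_recr //= opprK addKr NegzE.
exists (fun x => F x - F x0); split; first by rewrite subrr.
by move=> x; rewrite -FS; lia.
Qed.

Lemma xi_spec k eta : xi k eta (fine (s_inf eta 0)) = 0 /\
  forall x, xi k eta x - xi k eta (x - 1) =
    1 - \sum_(1 <= j < k.+1) (eta_up eta j x + eta_down eta j x).
Proof.
apply: (@xgetPex _ (fun=> 0) [set f : int -> int |
  f (fine (s_inf eta 0)) = 0 /\ forall x, f x - f (x - 1) =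
    1 - \sum_(1 <= j < k.+1) (eta_up eta j x + eta_down eta j x)]).
exact: int_primitive.
Qed.

Section Counting.
Variable a : nat -> bool.
Let cn n := (\sum_(0 <= m < n) a m)%N.

Lemma count_mono m n : (m <= n)%N -> (cn m <= cn n)%N.
Proof.
by move=> /subnKC <-; rewrite /cn [leqRHS](big_cat_nat (n := m)) ?leq_addr //= leq_addr.
Qed.

Lemma count_ivt n i : (i <= cn n)%N -> exists2 m, (m <= n)%N & cn m = i.
Proof.
elim: n => [|n IH].
  by rewrite /cn big_geq // leqn0 => /eqP ->; exists 0%N; rewrite // big_geq.
rewrite leq_eqVlt => /orP[/eqP ->|]; first by exists n.+1.
rewrite /cn big_nat_recr //= -/(cn n) => h.
have [|m mn hm] := IH; first by case: (a n) h; lia.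
by exists m => //; exact: leqW.
Qed.

Lemma count_hit n i : (i <= cn n)%N ->
  exists m, cn m = i /\ forall j, cn j = i -> (m <= j)%N.
Proof.
move=> /count_ivt[m _ hm].
have ex : exists m, cn m == i by exists m; apply/eqP.
case: (ex_minnP ex) => m0 /eqP h1 h2; exists m0; split=> // j /eqP; exact: h2.
Qed.

End Counting.

Section SolitonCount.
Variables (e : excursion) (k : nat).
Let eta := iota_exc e.
Let s := body e.
(** Says that none of the first [k + 1] seats moves at site [n + 1], which is when [xi]
    increases. *)
Let a (n : nat) : bool :=
  all (fun j => seat eta j.+1 n%:Z == eta n.+1%:Z) (iota 0 k.+1).
Let cn n := (\sum_(0 <= m < n) a m)%N.
Let h (y : int) := eta_up eta k.+1 y - eta_up eta k.+2 y.

Lemma xi_iota n : xi k.+1 eta n%:Z = (cn n)%:Z.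
Proof.
have [h0 hS] := xi_spec k.+1 eta.
elim: n => [|n IH]; first by rewrite /cn big_geq //; move: h0; rewrite iota_s_inf0.
have := hS n.+1%:Z; rewrite (_ : n.+1%:Z - 1 = n%:Z); last by lia.
rewrite IH sum_updown; last exact: iota_below.
rewrite (_ : n.+1%:Z - 1 = n%:Z); last by lia.
rewrite -/(a n) /cn big_nat_recr //= -/(cn n) => /eqP; rewrite subr_eq => /eqP ->.
by case: (a n); rewrite /=; lia.
Qed.

(** Left of site 0 no seat moves and [xi] is negative, so the sites [s_] of nonnegative levels are
    nonnegative. *)
Lemma xi_iota_neg n : xi k.+1 eta (- n%:Z) = - n%:Z.
Proof.
have [h0 hS] := xi_spec k.+1 eta.
elim: n => [|n IH]; first by rewrite oppr0; move: h0; rewrite iota_s_inf0.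
have := hS (- n%:Z); rewrite (_ : - n%:Z - 1 = - n.+1%:Z); last by lia.
rewrite IH sum_updown; last exact: iota_below.
rewrite (_ : all (fun j => seat eta j.+1 (- n%:Z - 1) == eta (- n%:Z)) (iota 0 k.+1)).
  by rewrite /=; lia.
have e0 : eta (- n%:Z) = false by apply: iota_le0; lia.
apply/allP => j _; rewrite e0.
by rewrite seat_iota_le0 //; lia.
Qed.

(** Just after the excursion a 0 meets empty seats, so [xi] increases there. Hence this is the first
    site at its level, and the last interval of [zeta_exc] ends exactly at it. *)
Lemma count_last : cn (size s).+1 = (cn (size s)).+1.
Proof.
rewrite /cn big_nat_recr //= (_ : a _ = true) ?addn1 //.
have e0 : eta (size s).+1%:Z = false by exact: iota_ge.
apply/allP => j _; rewrite e0.
have /(congr1 (fun f => f j)) := @seat_iota e (size s) (leqnn _).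
by rewrite take_size run_dyck => [->|]; last exact: body_dyck.
Qed.

Lemma s_iota i m : cn m = i -> (forall j, cn j = i -> (m <= j)%N) ->
  s_ k.+1 eta i%:Z = m%:Z.
Proof.
move=> hm hmin; rewrite /s_; apply: xget_unique.
  split; first by rewrite xi_iota hm.
  case=> [z|z] hz; first by rewrite lez_nat; apply: hmin; move: hz; rewrite xi_iota => -[].
  by move: hz; rewrite NegzE xi_iota_neg; lia.
move=> y [y1 y2]; apply/eqP; rewrite eq_le y2 /=; last by rewrite xi_iota hm.
case: y y1 y2 => [y|y] y1 _.
  by rewrite lez_nat; apply: hmin; move: y1; rewrite xi_iota => -[].
by move: y1; rewrite NegzE xi_iota_neg; lia.
Qed.

Lemma sum_fill_iota k' :
  \sum_(0 <= m < (size s).+1) eta_up eta k'.+1 m.+1%:Z = (ups k' s)%:Z.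
Proof.
rewrite -fills_ups fills_sum big_nat_recr //= -[RHS]natz natr_sum.
have e1 (m : nat) : m.+1%:Z - 1 = m%:Z by lia.
have e2 (m : nat) : eta m.+1%:Z = nth false s m.
  by rewrite (_ : m.+1%:Z = 1 + m%:Z); [exact: iota_body|lia].
have e3 m (hm : (m <= size s)%N) := @seat_iota e m hm.
have e4 m (hm : (m <= size s)%N) := congr1 (fun f => f k') (e3 m hm).
rewrite [X in _ + X](_ : _ = 0) ?addr0.
  apply: eq_big_nat => m /andP[_ hm].
  by rewrite /eta_up upE e1 e2 e3 1?e4 // ltnW.
have e0 : eta (size s).+1%:Z = false by exact: iota_ge.
rewrite /eta_up upE e1 e0 e3 1?e4 // take_size.
by rewrite run_dyck ?step_false_empty //; exact: body_dyck.
Qed.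

(** The intervals between consecutive [s_] tile the sites from 1 to [m]. *)
Lemma sum_zeta_iota j : (j <= cn (size s).+1)%N ->
  forall m, cn m = j -> (forall i, cn i = j -> (m <= i)%N) ->
  \sum_(0 <= i < j) zeta k.+1 eta i%:Z = \sum_(0 <= i < m) h i.+1%:Z.
Proof.
elim: j => [|j IH] hj m hm hmin.
  have -> : m = 0%N by apply/eqP; rewrite -leqn0; apply: hmin; rewrite /cn big_geq.
  by rewrite !big_geq.
have [m' [hm' hmin']] : exists m', cn m' = j /\ forall i, cn i = j -> (m' <= i)%N.
  exact: count_hit (ltnW hj).
have mm : (m' <= m)%N.
  have [//|/ltnW /(count_mono a)] := leqP m' m.
  by rewrite -/(cn m) -/(cn m') hm hm' ltnn.
rewrite big_nat_recr //= (IH (ltnW hj) m' hm' hmin') [RHS](big_cat_nat (n := m')) //=.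
congr (_ + _); rewrite /zeta.
have -> : j%:Z + 1 = j.+1%:Z by lia.
rewrite (s_iota hm' hmin') (s_iota hm hmin) -{1}(subnKC mm) PoszD fsbig_itv_oc.
rewrite -[X in \sum_(X <= i < m) _]add0n big_addn; apply: eq_bigr => i _.
by rewrite (_ : m'%:Z + i.+1%:Z = (i + m').+1%:Z) //; lia.
Qed.

Lemma zeta_excE : zeta_exc k.+1 e = (ups k s)%:Z - (ups k.+1 s)%:Z.
Proof.
rewrite /zeta_exc -/eta lenE -/s xi_iota.
have := fsbig_itv _ (cn (size s).+1) 0 (zeta k.+1 eta); rewrite add0r => ->.
under eq_bigr do rewrite add0r.
rewrite (@sum_zeta_iota _ (leqnn _) (size s).+1) //.
  by rewrite /h sumrB !sum_fill_iota.
move=> i hi; rewrite leqNgt ltnS; apply/negP => /(count_mono a).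
by rewrite -/(cn i) -/(cn _) hi count_last ltnn.
Qed.

End SolitonCount.

(** * Sums over excursions *)

Lemma ups_nil k s : iter k (red false) s = [::] -> ups k s = 0%N.
Proof. by rewrite /ups => ->. Qed.

(** Summation by parts, [rsize] decreasing by twice [ups] at each reduction. *)
Lemma sum_ups k n s : dyck s ->
  (2 * \sum_(0 <= l < n.+1) l%:Z * ((ups (k + l) s)%:Z - (ups (k + l).+1 s)%:Z) : int) =
  (rsize k.+1 s)%:Z - (rsize (k + n).+1 s)%:Z - 2 * n%:Z * (ups (k + n).+1 s)%:Z.
Proof.
move=> ds; elim: n => [|n IH]; first by rewrite big_nat1 addn0; lia.
rewrite big_nat_recr // mulrDr IH /= addnS.
by have := rsize_ups (k + n).+1 ds; rewrite -addnS; lia.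
Qed.

Section ExcursionSums.
Variable R : realType.
Implicit Types q : nat -> R.

(** The exponent is the number of sites left after [k + 1] reductions, initial site included, that
    is, the number of slots at that stage. *)
Lemma soliton_exponent k e :
  1 + 2 * \sum_(l \in [set l | (0 < l)%N]) (l%:Z * zeta_exc (k.+1 + l) e) =
  (rsize k.+1 (body e)).+1%:Z.
Proof.
set s := body e; have ds : dyck s := body_dyck e.
have [K hK] := dyck_level ds.
have zE l : zeta_exc (k.+1 + l) e = (ups (k + l) s)%:Z - (ups (k + l).+1 s)%:Z.
  by rewrite addSn zeta_excE.
have nil j : (K <= j)%N -> ups j s = 0%N.
  by move=> hj; apply: ups_nil; exact: level_iter_ge hj.
rewrite (@fsbig_widen _ _ _ _ [set l | (0 < l)%N] setT) //; last first.
  by move=> [|l] [_ /=] // _; rewrite mul0r.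
rewrite -(@fsbig_widen _ _ _ _ `I_K.+1 setT) //; last first.
  move=> l [_ /= /negP]; rewrite -leqNgt => hl.
  by rewrite zE !nil ?subrr ?mulr0 //; lia.
rewrite -(@fsbig_ord _ _ _ K.+1 (fun l => l%:Z * zeta_exc (k.+1 + l) e)).
rewrite -(big_mkord xpredT (fun l => l%:Z * zeta_exc (k.+1 + l) e)).
under eq_bigr do rewrite zE.
rewrite sum_ups // nil; last by lia.
have -> : rsize (k + K).+1 s = 0%N by rewrite /rsize (level_iter_ge hK) //; lia.
by lia.
Qed.

Lemma varphi_wt q e : varphi q e = limn (fun n => wt n q (body e)).
Proof.
rewrite /varphi; congr (lim (_ @ \oo)); apply/funext => n.
rewrite big_add1 /=; apply: eq_bigr => k _.
rewrite soliton_exponent zeta_excE subzn //.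
exact: ups_anti (body_dyck e).
Qed.

Lemma wt_level q K n s : level K s -> (K <= n)%N ->
  wt n q s = wt K q s * \prod_(K <= k < n) (1 - q k.+1).
Proof.
move=> hK Kn; rewrite /wt (big_cat_nat (n := K)) //=; congr (_ * _).
apply: eq_big_nat => k /andP[Kk _].
have nil j : (K <= j)%N -> iter j (red false) s = [::] by exact: level_iter_ge.
rewrite !ups_nil ?nil ?(leqW Kk) // /rsize nil ?(leqW Kk) //.
by rewrite subnn expr0 expr1 mul1r.
Qed.

Lemma wt_cvg q K s (l : R) : level K s ->
  (fun n => \prod_(K <= k < n) (1 - q k.+1)) @ \oo --> l ->
  (fun n => wt n q s) @ \oo --> wt K q s * l.
Proof.
move=> hK hl.
apply: (@cvg_trans _ ((fun n => wt K q s * \prod_(K <= k < n) (1 - q k.+1)) @ \oo)).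
  apply: near_eq_cvg; near=> n; rewrite -wt_level //.
  by near: n; exact: nbhs_infty_ge.
by apply: cvgM => //; exact: cvg_cst.
Unshelve. all: by end_near.
Qed.

Lemma le_esum_subset (T : choiceType) (A B : set T) (a : T -> \bar R) :
  A `<=` B -> (esum A a <= esum B a)%E.
Proof.
move=> AB; apply: ge_ereal_sup => _ [X [fX XA] <-].
by apply: ereal_sup_ubound; exists X => //; split => //; exact: subset_trans AB.
Qed.

Lemma body_inj : injective body.
Proof.
by move=> e e' h; apply: val_inj; rewrite !excursionE h.
Qed.

Lemma body_image : body @` [set: excursion] = [set s | dyck s].
Proof.
apply/seteqP; split => [_ [e _ <-]|s /= ds]; first exact: body_dyck.
by exists (Sub (false :: s) ((is_excursionP s).2 ds)); rewrite // /body SubK.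
Qed.

(** On words of level [K], [varphi q] is [wt K q] times [l K], the factor for having no larger
    soliton. The sums [l K * v K] increase to the full sum, and [l K] tends to 1. *)
Lemma esum_excursion q (F : seq bool -> R) (l v : nat -> R) (L : R) :
  unit_weights q -> (forall s, 0 <= F s) ->
  (forall K, (fun n => \prod_(K <= k < n) (1 - q k.+1)) @ \oo --> l K) ->
  l @ \oo --> (1 : R) ->
  (forall K, expect K q F = (v K)%:E) -> v @ \oo --> L ->
  (\esum_(e in [set: excursion]) (F (body e) * varphi q e)%:E = L%:E)%E.
Proof.
move=> hq F0 hl l1 hv vL.
pose g (s : seq bool) := limn (fun n => wt n q s).
transitivity (\esum_(s in [set s | dyck s]) (F s * g s)%:E)%E.
  rewrite -body_image esum_image; last by move=> e e' _ _; exact: body_inj.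
  by apply: eq_esum => e _; rewrite varphi_wt.
have gE K s : level K s -> g s = wt K q s * l K.
  by move=> hs; apply/cvg_lim => //; exact: wt_cvg.
have l0 K : 0 <= l K.
  apply: (cvgr_to_ge (hl K)); apply: nearW => n.
  by apply: prodr_ge0 => k _; case/andP: (hq k.+1 isT) => _ h; rewrite subr_ge0 ltW.
pose u K := l K * v K.
have uE K : (\esum_(s in [set s | level K s]) (F s * g s)%:E = (u K)%:E)%E.
  rewrite /u EFinM -hv /expect -esumZl //; last first.
    by move=> s; rewrite lee_fin mulr_ge0 // wt_ge0.
  apply: eq_esum => s hs; rewrite -EFinM (gE K) //; congr EFin; ring.
have uL : u @ \oo --> L by rewrite -[L]mul1r; exact: cvgM.
have und : nondecreasing_seq u.
  move=> m n mn; rewrite -lee_fin -!uE; apply: le_esum_subset => s.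
  exact: level_le.
have u_le K : u K <= L.
  by rewrite -(cvg_lim (@Rhausdorff R) uL); apply: nondecreasing_cvgn_le => //; exact: cvgP uL.
apply/eqP; rewrite eq_le; apply/andP; split.
  (* A finite set of Dyck words has a bounded level, so each finite sum is below some [u K]. *)
  apply: ge_ereal_sup => _ [X [fX XD] <-].
  have ex s : exists K, dyck s -> level K s.
    have [/dyck_level[K hK]|nd] := pselect (dyck s); first by exists K.
    by exists 0%N.
  have [k hk] := choice ex.
  have [r rE] := (finite_seqP X).1 fX; pose K := \max_(s <- r) k s.
  have XK : X `<=` [set s | level K s].
    move=> s Xs; apply: level_le (hk s (XD s Xs)).
    by apply: leq_bigmax_seq => //; move: Xs; rewrite rE.
  apply: le_trans (_ : (u K)%:E <= _)%E; last by rewrite lee_fin.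
  by rewrite -uE; apply: ereal_sup_ubound; exists X.
have {}uE K : ((u K)%:E <= \esum_(s in [set s | dyck s]) (F s * g s)%:E)%E.
  by rewrite -uE; apply: le_esum_subset => s; exact: level_dyck.
case e : (esum _ _) => [r||]; last 2 first.
- by rewrite leey.
- by have := uE 0%N; rewrite e.
rewrite lee_fin; apply: (cvgr_to_le uL); apply: nearW => K.
by have := uE K; rewrite e lee_fin.
Qed.

End ExcursionSums.

Section QcdExcursions.
Variables (R : realType) (c d : R) (q : nat -> R).
Hypotheses (hc : 0 <= c < 1) (hd : 0 <= d < 1).
Hypothesis hq : forall k, (0 < k)%N -> q k = qcd c d k.

Lemma unit_weights_qcd : unit_weights q.
Proof. by move=> k k0; rewrite hq //; exact: qcd_unit. Qed.

Lemma esum_qcd (F : seq bool -> R) (v : nat -> R) (L : R) :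
  (forall s, 0 <= F s) -> (forall K, expect K q F = (v K)%:E) ->
  v @ \oo --> L ->
  (\esum_(e in [set: excursion]) (F (body e) * varphi q e)%:E = L%:E)%E.
Proof.
move=> F0 hv vL; have ht := cvg_tail hc hd.
apply: (@esum_excursion _ q F
  (fun K => (1 - c ^+ K * d) / (1 - c ^+ K.+1 * d)) v L unit_weights_qcd F0 _ _ hv vL).
- move=> K; rewrite -[X in _ --> X]mulr1.
  apply: (@cvg_trans _ ((fun n => (1 - c ^+ K * d) / (1 - c ^+ K.+1 * d) *
     ((1 - c ^+ n.+1 * d) / (1 - c ^+ n * d))) @ \oo)).
    apply: near_eq_cvg; near=> n; rewrite -prod_qcd //.
      by apply: eq_bigr => k _; rewrite hq.
    by near: n; exact: nbhs_infty_ge.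
  by apply: cvgM => //; exact: cvg_cst.
- rewrite -[X in _ --> X]invr1 (_ : (fun K => _) =
    (fun K => ((1 - c ^+ K.+1 * d) / (1 - c ^+ K * d))^-1)).
    by apply: cvgV => //; exact: oner_neq0.
  by apply/funext => K; rewrite invf_div.
Unshelve. all: by end_near.
Qed.

Lemma esum_len : (mean_len q = ((1 + d) / (1 - d))%:E)%E.
Proof.
rewrite -(@esum_qcd (@etot R site_obs) (fun K => mu c d (c ^+ K) K%:R)).
- by apply: eq_esum => e _; rewrite /etot tot_site lenE.
- by move=> s; exact: ler0n.
- by move=> K; rewrite (expect_site K unit_weights_qcd).1 (moments_qcd K hc hd hq).
- exact: mu_cvg.
Qed.

Lemma esum_seat k :
  (\esum_(e in [set: excursion]) (etot R (seat_obs k) (body e) * varphi q e)%:E =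
   (((1 + d) / (1 - d) - mu c d (c ^+ k) k%:R) / 2)%:E)%E.
Proof.
apply: (@esum_qcd (@etot R (seat_obs k)) (fun K => (mu c d (c ^+ K) K%:R -
   mu c d (c ^+ (minn k K)) (minn k K)%:R) / 2)).
- by move=> s; exact: ler0n.
- move=> K; rewrite (expect_seat k K unit_weights_qcd).1.
  by rewrite !(moments_qcd _ hc hd hq).
apply: (@cvg_trans _ ((fun K => (mu c d (c ^+ K) K%:R - mu c d (c ^+ k) k%:R) / 2) @ \oo)).
  apply: near_eq_cvg; near=> n; rewrite (minn_idPl _) //.
  by near: n; exact: nbhs_infty_ge.
apply: cvgM; last exact: cvg_cst.
by apply: cvgB; [exact: mu_cvg|exact: cvg_cst].
Unshelve. all: by end_near.
Qed.

End QcdExcursions.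

(** * Measurability *)

Section Measurability.
Implicit Types (P : nat -> set config) (A B : set config).

Lemma measurable_forall P : (forall n, measurable (P n)) ->
  measurable [set eta : config | forall n, P n eta].
Proof.
move=> h; rewrite (_ : [set _ | _] = \bigcap_n P n); first exact: bigcapT_measurable.
by apply/seteqP; split => eta /= H n; [move=> _|]; exact: H.
Qed.

Lemma measurable_exists P : (forall n, measurable (P n)) ->
  measurable [set eta : config | exists n, P n eta].
Proof.
move=> h; rewrite (_ : [set _ | _] = \bigcup_n P n); first exact: bigcupT_measurable.
by apply/seteqP; split => eta /= [n]; [exists n|move=> _; exists n].
Qed.

Lemma measurable_letter (x : int) (b : bool) :
  measurable [set eta : config | eta x = b].
Proof. by apply: sub_gen_smallest; exists x, b. Qed.

Lemma measurable_word (a : int) (n : nat) (Q : seq bool -> Prop) :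
  measurable [set eta : config | Q (word eta a n)].
Proof.
elim: n Q => [|n IH] Q.
  have [hQ|hQ] := pselect (Q [::]).
    by rewrite (_ : [set _ | _] = setT) //; apply/seteqP; split.
  by rewrite (_ : [set _ | _] = set0) //; apply/seteqP; split.
rewrite (_ : [set _ | _] =
  ([set eta : config | Q (rcons (word eta a n) true)] `&`
     [set eta : config | eta (a + n%:Z) = true]) `|`
  ([set eta : config | Q (rcons (word eta a n) false)] `&`
     [set eta : config | eta (a + n%:Z) = false])).
  apply: measurableU; apply: measurableI; try exact: measurable_letter.
    exact: (IH (fun s => Q (rcons s true))).
  exact: (IH (fun s => Q (rcons s false))).
apply/seteqP; split => eta /=; rewrite wordSr.
  by case: (eta _) => h; [left|right].
by move=> [] [h ->].
Qed.

Lemma measurable_record (x : int) :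
  measurable [set eta : config | is_record eta x].
Proof.
rewrite (_ : [set _ | _] =
  [set eta : config | forall n : nat, hgt (word eta (x - n%:Z) n.+1) < 0]).
  apply: (measurable_forall (P := fun n => [set eta : config |
    hgt (word eta (x - n%:Z) n.+1) < 0])) => n.
  exact: (measurable_word _ _ (fun s => hgt s < 0)).
by apply/seteqP; split => eta /= /is_recordP.
Qed.

Lemma measurable_unbounded_below :
  measurable [set eta : config | unbounded_below (is_record eta)].
Proof.
rewrite (_ : [set _ | _] = [set eta : config | forall n : nat, exists m : nat,
   is_record eta (- n%:Z - m%:Z)]).
  apply: (measurable_forall (P := fun n => [set eta : config | exists m : nat,
    is_record eta (- n%:Z - m%:Z)])) => n.
  apply: (measurable_exists (P := fun m => [set eta : config |
    is_record eta (- n%:Z - m%:Z)])) => m.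
  exact: measurable_record.
apply/seteqP; split => eta /= h.
  move=> n; have [r rn hr] := h (- n%:Z); exists (absz (- n%:Z - r)%R).
  by rewrite (_ : _ - _ = r) //; lia.
move=> x; have [m hm] := h (absz x); exists (- (absz x)%:Z - m%:Z) => //; lia.
Qed.

Lemma measurable_unbounded_above :
  measurable [set eta : config | unbounded_above (is_record eta)].
Proof.
rewrite (_ : [set _ | _] = [set eta : config | forall n : nat, exists m : nat,
   is_record eta (n%:Z + m%:Z)]).
  apply: (measurable_forall (P := fun n => [set eta : config | exists m : nat,
    is_record eta (n%:Z + m%:Z)])) => n.
  apply: (measurable_exists (P := fun m => [set eta : config |
    is_record eta (n%:Z + m%:Z)])) => m.
  exact: measurable_record.
apply/seteqP; split => eta /= h.
  move=> n; have [r rn hr] := h n%:Z; exists (absz (r - n%:Z)%R).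
  by rewrite (_ : _ + _ = r) //; lia.
move=> x; have [m hm] := h (absz x); exists ((absz x)%:Z + m%:Z) => //; lia.
Qed.

Lemma measurable_seatR (x : int) k : measurable [set eta : config | seatR eta x k].
Proof.
rewrite (_ : [set _ | _] = [set eta : config | exists n : nat,
  ([set eta : config | is_record eta (x - n%:Z)] `&`
   [set eta : config | run empty (word eta (x - n%:Z + 1) n) k]) eta]).
  apply: (measurable_exists (P := fun n =>
    [set eta : config | is_record eta (x - n%:Z)] `&`
    [set eta : config | run empty (word eta (x - n%:Z + 1) n) k])) => n.
  apply: measurableI; first exact: measurable_record.
  exact: (measurable_word _ _ (fun s => run empty s k)).
by apply/seteqP; split => eta /= /asboolP.
Qed.

Variable R : realType.

Definition mean_past (eta : int -> bool) (n : nat) : R :=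
  n%:R^-1 * \sum_(0 <= y < n.+1) (eta (- y%:Z))%:R.

(** Averages of different lengths are read off one word, so that [measurable_word] applies to events
    comparing two of them. *)
Lemma mean_past_word eta n m : (n <= m)%N -> mean_past eta n =
  n%:R^-1 * \sum_(b <- drop (m - n) (word eta (- m%:Z) m.+1)) b%:R.
Proof.
move=> nm; rewrite /mean_past; congr (_ * _).
rewrite (_ : m.+1 = ((m - n) + n.+1)%N); last by lia.
rewrite drop_word (_ : _ + _ = - n%:Z); last by lia.
rewrite big_map /index_iota subn0 -[in RHS](subn0 n.+1) -/(index_iota 0 n.+1).
rewrite big_nat_rev /=; apply: eq_big_nat => i hi; congr (_%:R).
by congr (nat_of_bool (eta _)); lia.
Qed.

Lemma invS_lt (e : R) : 0 < e -> exists j, (j.+1%:R^-1 : R) < e.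
Proof.
move=> e0; exists (Num.truncn e^-1); rewrite invf_plt ?posrE //.
exact: truncnS_gt.
Qed.

(** The limit ranges over an uncountable set; the Cauchy criterion and a rational margin below 1/2
    give countably many conditions instead. *)
Lemma OmegaP eta : Omega R eta <->
  (forall j, exists N, forall m,
     `|mean_past eta (N + m) - mean_past eta N| < j.+1%:R^-1) /\
  (exists j N, forall m, mean_past eta (N + m) <= 1 / 2 - j.+1%:R^-1).
Proof.
rewrite /Omega /= -[X in (exists2 l, X @ _ --> l & _)]/(mean_past eta).
split=> [[l ul l2]|[hC [j [N hN]]]].
  split=> [j|].
    have j0 : 0 < (j.+1%:R^-1 / 2 : R) by rewrite divr_gt0 ?invr_gt0.
    have /cvgrPdist_lt /(_ _ j0)[N _ hN] := ul.
    exists N => m; have h1 := hN N (leqnn N); have h2 := hN (N + m)%N (leq_addr m N).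
    rewrite /= in h1 h2.
    rewrite (_ : _ - _ = (l - mean_past eta N) - (l - mean_past eta (N + m))); last by ring.
    apply: le_lt_trans (ler_normB _ _) _.
    by rewrite [ltRHS]splitr; exact: ltrD.
  have e0 : 0 < 1 / 2 - l by rewrite subr_gt0.
  have [j hj] := invS_lt e0.
  have h : l < 1 / 2 - j.+1%:R^-1 by rewrite ltrBrDl -ltrBrDr.
  have [N _ hN] := cvgr_le _ ul _ h.
  by exists j, N => m; apply: hN; rewrite /= leq_addr.
have cu : cvg (mean_past eta @ \oo).
  apply/cauchy_cvgP; apply: cauchy_exP => e e0.
  have [i hi] := invS_lt e0.
  have [N' hN'] := hC i; exists (mean_past eta N'), N' => // n /= hn.
  rewrite /ball /= distrC; apply: lt_trans hi.
  by have := hN' (n - N')%N; rewrite subnKC.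
exists (limn (mean_past eta)) => //.
apply: le_lt_trans (_ : 1 / 2 - j.+1%:R^-1 < _); last by rewrite gtrBl invr_gt0.
apply: (cvgr_to_le cu); exists N => // n /= hn.
by have := hN (n - N)%N; rewrite subnKC.
Qed.

Lemma measurable_Omega : measurable (Omega R : set config).
Proof.
pose C j N m := [set eta : config |
  `|mean_past eta (N + m) - mean_past eta N| < j.+1%:R^-1].
pose D j N m := [set eta : config | mean_past eta (N + m) <= 1 / 2 - j.+1%:R^-1].
rewrite (_ : Omega R = [set eta | forall j, exists N, forall m, C j N m eta] `&`
  [set eta | exists j N, forall m, D j N m eta]); last first.
  by apply/seteqP; split => eta /OmegaP.
apply: measurableI.
  apply: (measurable_forall (P := fun j => [set eta | exists N, forall m, C j N m eta])) => j.
  apply: (measurable_exists (P := fun N => [set eta | forall m, C j N m eta])) => N.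
  apply: measurable_forall => m; rewrite /C.
  under eq_set => eta do rewrite (mean_past_word eta (leqnn (N + m)%N))
    (mean_past_word eta (leq_addr m N)).
  exact: (measurable_word _ _ (fun s => `|(N + m)%:R^-1 *
    \sum_(b <- drop (N + m - (N + m)) s) b%:R - N%:R^-1 *
    \sum_(b <- drop (N + m - N) s) b%:R| < j.+1%:R^-1)).
apply: (measurable_exists (P := fun j => [set eta | exists N, forall m, D j N m eta])) => j.
apply: (measurable_exists (P := fun N => [set eta | forall m, D j N m eta])) => N.
apply: measurable_forall => m; rewrite /D.
under eq_set => eta do rewrite (mean_past_word eta (leqnn (N + m)%N)).
exact: (measurable_word _ _ (fun s => (N + m)%:R^-1 *
    \sum_(b <- drop (N + m - (N + m)) s) b%:R <= 1 / 2 - j.+1%:R^-1)).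
Qed.

Lemma measurable_Omega_r : measurable (Omega_r R : set config).
Proof.
rewrite (_ : Omega_r R = (Omega R : set config) `&`
  [set eta | unbounded_below (is_record eta)] `&`
  [set eta | unbounded_above (is_record eta)] `&`
  [set eta | is_record eta 0]).
  by do 3?apply: measurableI; [exact: measurable_Omega|
    exact: measurable_unbounded_below|exact: measurable_unbounded_above|
    exact: measurable_record].
by apply/seteqP; split => eta; [move/Omega_rP => -[]|move=> [[[? ?] ?] ?]; apply/Omega_rP].
Qed.

End Measurability.

(** * Concatenated excursions *)

Section Concat.
Variable e : int -> excursion.

Lemma startS i : start e (i + 1) = start e i + (len (e i))%:Z.
Proof.
have itv0 (a b : int) : b <= a -> [set` `[a, b[] = set0.
  by move=> ba; apply/seteqP; split => x //=; rewrite in_itv /=; lia.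
rewrite /start; case: i => [n|n].
  rewrite (itv0 n%:Z 0) // (itv0 (n%:Z + 1) 0); last by lia.
  rewrite !fsbig_set0 !subr0.
  have := fsbig_itv _ n.+1 0 (fun j => (len (e j))%:Z); rewrite add0r => h1.
  have := fsbig_itv _ n 0 (fun j => (len (e j))%:Z); rewrite add0r => h2.
  rewrite (_ : n%:Z + 1 = n.+1%:Z); last by lia.
  by rewrite h1 h2 big_nat_recr //= add0r.
rewrite (itv0 0 (Negz n)) // (itv0 0 (Negz n + 1)); last by lia.
rewrite !fsbig_set0 !sub0r.
have := fsbig_itv _ n.+1 (Negz n) (fun j => (len (e j))%:Z).
rewrite (_ : Negz n + n.+1%:Z = 0); last by lia.
have := fsbig_itv _ n (Negz n + 1) (fun j => (len (e j))%:Z).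
rewrite (_ : Negz n + 1 + n%:Z = 0); last by lia.
move=> -> ->; rewrite big_nat_recl // addr0 opprD addrAC addNr add0r.
by congr (- _); apply: eq_bigr => j _; rewrite -addrA; do 3 f_equal; lia.
Qed.

Lemma start0 : start e 0 = 0.
Proof.
rewrite /start (_ : [set` `[0, 0[] = set0) ?fsbig_set0 //.
by apply/seteqP; split => x //=; rewrite in_itv /=; lia.
Qed.

Lemma start_lt i : start e i < start e (i + 1).
Proof. by rewrite startS lenE; lia. Qed.

Lemma concat_start i m : (m < len (e i))%N ->
  concat e (start e i + m%:Z) = nth false (val (e i)) m.
Proof.
rewrite /concat; move: i m; apply: (@getPex _ [set eta : int -> bool |
  forall (i : int) (m : nat), (m < len (e i))%N ->
  eta (start e i + m%:Z) = nth false (val (e i)) m]).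
have [f hf] := choice (incr_surround start_lt).
exists (fun x => nth false (val (e (f x))) (absz (x - start e (f x))%R)) => i m hm.
have fE : f (start e i + m%:Z) = i.
  have /andP[h1 h2] := hf (start e i + m%:Z).
  have h3 : start e i + m%:Z < start e (i + 1) by rewrite startS; lia.
  have [h|h|//] := ltgtP (f (start e i + m%:Z)) i.
    have [h4|h4] := eqVneq (f (start e i + m%:Z) + 1) i.
      by move: h2; rewrite h4; lia.
    have := incr_lt start_lt (_ : f (start e i + m%:Z) + 1 < i).
    by move=> h5; have h6 := h5 ltac:(lia); move: (lt_trans h2 h6); lia.
  have [h4|h4] := eqVneq (i + 1) (f (start e i + m%:Z)).
    by move: h1; rewrite -h4; lia.
  have := incr_lt start_lt (_ : i + 1 < f (start e i + m%:Z)).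
  by move=> h5; have h6 := h5 ltac:(lia); move: (lt_le_trans h6 h1); lia.
by rewrite fE; congr nth; lia.
Qed.

Lemma concat_word n : (n <= size (body (e 0)))%N ->
  word (concat e) 1 n = take n (body (e 0)).
Proof.
move=> hn; apply: (@eq_from_nth _ false); first by rewrite size_word size_takel.
move=> i; rewrite size_word => hi; rewrite nth_mkseq // nth_take //.
have := @concat_start 0 i.+1; rewrite start0 add0r lenE excursionE /= => <-.
  by congr concat; lia.
by rewrite ltnS; exact: leq_trans hi hn.
Qed.

Lemma concat_next : concat e (size (body (e 0))).+1%:Z = false.
Proof.
have := @concat_start 1 0; rewrite lenE => /(_ isT).
rewrite excursionE /= addr0 -{1}[1]add0r startS start0 add0r lenE.
exact.
Qed.

End Concat.

(* If 0 is a record: y precedes the next record and seat k + 1 is occupied at y. *)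
Definition in_first (k y : nat) (eta : int -> bool) : Prop :=
  (forall m, (m <= y)%N -> 0 <= hgt (word eta 1 m)) /\ run empty (word eta 1 y) k.

(** Leaving the first excursion is detected by the initial 0 of the next one, which brings the
    height down to -1. *)
Lemma in_first_concat k y e : in_first k y (concat e) <->
  (y <= size (body (e 0)))%N /\ run empty (take y (body (e 0))) k.
Proof.
split=> [[h1 h2]|[h1 h2]].
  have yN : (y <= size (body (e 0)))%N.
    rewrite leqNgt; apply/negP => hy; have := h1 _ hy.
    rewrite wordSr concat_word // take_size -cats1 hgt_cat hgt_cons hgt_nil.
    have -> : 1 + (size (body (e 0)))%:Z = (size (body (e 0))).+1%:Z by lia.
    rewrite concat_next.
    by case: (body_dyck (e 0)) => _ ->.
  by split => //; rewrite -concat_word.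
split; last by rewrite concat_word.
move=> m hm; rewrite concat_word; last exact: leq_trans hm h1.
by case: (body_dyck (e 0)).
Qed.

Lemma measurable_in_first k y :
  measurable [set eta : config | in_first k y eta].
Proof.
rewrite (_ : [set _ | _] = [set eta : config | (fun s =>
   (forall m, (m <= y)%N -> 0 <= hgt (take m s)) /\ run empty s k) (word eta 1 y)]).
  exact: (measurable_word _ _ (fun s =>
    (forall m, (m <= y)%N -> 0 <= hgt (take m s)) /\ run empty s k)).
apply/seteqP; split => eta /= [h1 h2]; split=> // m hm.
  by rewrite take_word //; exact: h1.
by rewrite -(take_word _ _ hm); exact: h1.
Qed.

Lemma first_record eta (n : nat) y : is_record eta 0 -> is_record eta n.+1%:Z ->
  (forall y : nat, (0 < y <= n)%N -> ~ is_record eta y%:Z) ->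
  (y <= n)%N <-> (forall m, (m <= y)%N -> 0 <= hgt (word eta 1 m)).
Proof.
move=> /is_recordP h0 /is_recordP hn hno; split=> [yn|h]; last first.
  rewrite leqNgt; apply/negP => ny; have := hn n; have := h _ ny.
  by rewrite (_ : n.+1%:Z - n%:Z = 1); [lia|lia].
move=> m my; rewrite leNgt; apply/negP => hm.
have ex : exists m, hgt (word eta 1 m) < 0 by exists m.
(* The first negative height would occur at a record [p <= n]: stretches within the first [p]
   letters are negative by minimality, longer ones by adding a stretch ending at the record 0. *)
case: (ex_minnP ex) => p hp pmin.
have p0 : (0 < p)%N by case: p hp {pmin} => //; rewrite /word /= hgt_nil.
apply: (hno p); first by rewrite p0 /= (leq_trans (pmin m hm)) // (leq_trans my).
apply/is_recordP => j; have [jp|pj] := ltnP j p.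
  have pE : p = ((p - j.+1) + j.+1)%N by lia.
  move: hp; rewrite {1}pE word_add hgt_cat (_ : 1 + _ = p%:Z - j%:Z); last by lia.
  have : 0 <= hgt (word eta 1 (p - j.+1)).
    by rewrite leNgt; apply/negP => /pmin; lia.
  by move: (hgt _) (hgt _) => a b; lia.
have jE : j.+1 = ((j - p).+1 + p)%N by lia.
rewrite jE word_add hgt_cat (_ : p%:Z - j%:Z = 0 - (j - p)%N%:Z); last by lia.
rewrite (_ : 0 - _ + _ = 1); last by lia.
by rewrite -[ltRHS]addr0; apply: ltrD.
Qed.

(** * The stationary seat densities *)

Lemma tot_sum o w s :
  (o w + tot o w s)%N = (\sum_(0 <= y < (size s).+1) o (run w (take y s)))%N.
Proof.
elim: s w => [|b s IH] w; first by rewrite big_nat1 addn0.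
by rewrite big_nat_recl //= IH.
Qed.

Lemma esum_swap (R : realType) (S T : choiceType) (f : S -> T -> \bar R) :
  (forall i j, (0 <= f i j)%E) ->
  (\esum_(i in [set: S]) \esum_(j in [set: T]) f i j =
   \esum_(j in [set: T]) \esum_(i in [set: S]) f i j)%E.
Proof.
move=> f0; rewrite !esum_esum //.
apply: (@reindex_esum _ _ _ _ _ (fun p : T * S => (p.2, p.1))); split => //.
- by move=> [i j] [i' j'] _ _ [-> ->].
- by move=> [i j] _; exists (j, i).
Qed.

Lemma nneseries_cst0 (R : realType) (g : nat -> \bar R) n :
  (forall y, (n < y)%N -> g y = 0%E) ->
  (\sum_(0 <= y <oo) g y = \sum_(0 <= y < n.+1) g y)%E.
Proof.
move=> g0; apply/cvg_lim => //; apply: cvg_near_cst; near=> N.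
rewrite (@big_cat_nat _ _ _ n.+1) //=; last by near: N; exact: nbhs_infty_ge.
rewrite [X in (_ + X)%E]big1_seq ?adde0 // => i /andP[_].
by rewrite mem_index_iota => /andP[ni _]; exact: g0.
Unshelve. all: by end_near.
Qed.

Lemma probability_countable (R : realType) (d : measure_display)
    (T : measurableType d) (P : probability T R) (E : countType) (X : T -> E)
    (Y : set E) : (forall A : set E, measurable (X @^-1` A)) ->
  (P (X @^-1` Y) = \esum_(a in Y) P (X @^-1` [set a]))%E.
Proof.
move=> hX; pose F n := X @^-1` (Y `&` [set a | pickle a = n]).
have -> : X @^-1` Y = \bigcup_(n in pickle @` Y) F n.
  apply/seteqP; split => [w hw|w [n _ []] //].
  by exists (pickle (X w)); [exists (X w)|split].
rewrite measure_bigcup; last 2 first.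
- by move=> n _; exact: hX.
- by move=> i j _ _ [w [[_ /= <-] [_ /= <-]]].
rewrite nneseries_esum // set_mem_set esum_image; last first.
  by move=> a b _ _; exact: (pcan_inj pickleK).
apply: eq_esum => a Ya; congr (P _); apply/seteqP; split => w.
  by move=> [_ /= /(pcan_inj pickleK)].
by rewrite /F /= => ->.
Qed.

Section Density.
Variables (R : realType) (q : nat -> R) (nu mu : probability config R).
Hypotheses (hnu : is_phihat q nu) (hmu : is_phi q nu mu).

Let seated k : set config := [set eta | seatR eta 0 k].

(** The shift by [y] moves the record 0 to [- y], so site 0 is reached by reading letters 1 to [y]
    of [eta]. A series with a range independent of [eta] can be exchanged with the integral. *)
Lemma shift_seated k eta n : s_inf eta 1 = n.+1%:Z%:E -> is_record eta 0 ->
  is_record eta n.+1%:Z ->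
  (forall y : nat, (0 < y <= n)%N -> ~ is_record eta y%:Z) ->
  (\sum_(y \in `[0%R, fine (s_inf eta 1)[) (\1_(seated k) (Defs.shift y eta) : R)%:E =
   \sum_(0 <= y <oo) (\1_([set eta : config | in_first k y eta]) eta : R)%:E)%E.
Proof.
move=> e1 h0 hn hno; rewrite e1 /=.
have := fsbig_itv _ n.+1 0 (fun y => (\1_(seated k) (Defs.shift y eta) : R)%:E).
rewrite add0r => ->.
have fr y := first_record y h0 hn hno.
rewrite (@nneseries_cst0 _ _ n); last first.
  move=> y ny; rewrite indicE memNset // => -[h _].
  by have /fr := h; rewrite leqNgt ny.
apply: eq_big_nat => y /andP[_ yn]; rewrite !indicE; congr ((nat_of_bool _)%:R%:E).
have hr : is_record (Defs.shift y%:Z eta) (- y%:Z).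
  by apply/is_record_shift; rewrite addNr.
have hs := seatRE y k hr; rewrite addNr word_shift in hs.
rewrite (_ : - y%:Z + 1 + y%:Z = 1) in hs; last by lia.
rewrite add0r; apply/idP/idP; rewrite !inE /seated /= hs.
  by split => //; apply/fr.
by case.
Qed.

Lemma phihat_full (B : set config) : measurable B ->
  (nu (B `&` Omega_r R) = nu B)%E.
Proof.
move=> mB; have mO := measurable_Omega_r R.
rewrite (measureDI nu mB mO) [X in (_ = X + _)%E](_ : _ = 0%E) ?add0e //.
apply/eqP; rewrite eq_le measure_ge0 andbT.
apply: (@le_trans _ _ (nu (~` (Omega_r R : set config)))).
  apply: le_measure; rewrite ?inE; [exact: measurableD|exact: measurableC|].
  by move=> eta [].
have := probability_setC nu mO; case: hnu => -> _ ->.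
by rewrite subee.
Qed.

Lemma phihat_first k y : nu [set eta : config | in_first k y eta] =
  (\esum_(a in [set: excursion])
     (((y <= size (body a))%N && run empty (take y (body a)) k)%:R * varphi q a)%:E)%E.
Proof.
case: hnu => _ [d [T [P [e [[hm hP _] hA]]]]].
rewrite hA; last exact: measurable_in_first.
pose Y : set excursion := [set a |
  (y <= size (body a))%N && run empty (take y (body a)) k].
rewrite (_ : [set w | _] = e 0 @^-1` Y); last first.
  apply/seteqP; split => w /=; first by move/in_first_concat => [h1 h2]; apply/andP.
  by move=> /andP hw; apply/in_first_concat.
rewrite probability_countable // esum_mkcond; apply: eq_esum => a _.
rewrite hP; have -> : (a \in Y) = (y <= size (body a))%N && run empty (take y (body a)) k.
  by apply/idP/idP; rewrite inE.
by case: (_ && _); rewrite ?mul1r ?mul0r.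
Qed.

(** Each value is the probability of an atom, so no convergence of the product is needed. *)
Lemma varphi_ge0 a : 0 <= varphi q a.
Proof.
case: hnu => _ [d [T [P [e [[_ hP _] _]]]]].
by rewrite -lee_fin -(hP 0); exact: measure_ge0.
Qed.

(** Palm inversion: the series over sites is exchanged with the integral, each site gives a sum over
    the excursion at 0, and exchanging the two sums leaves the number of occupied sites of each
    excursion. *)
Lemma WbarE k : (Wbar mu k.+1 = ((fine (mean_len q))^-1)%:E *
  \esum_(a in [set: excursion]) (etot R (seat_obs k) (body a) * varphi q a)%:E)%E.
Proof.
have mA : measurable (seated k) by exact: measurable_seatR.
(* The defining formula of phi asks for a function measurable on the whole space, hence [seatR],
   which agrees with [seat] on [Omega_star]. *)
transitivity (\int[mu]_(eta in Omega_star R) (\1_(seated k) eta : R)%:E)%E.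
  apply: eq_integral => eta; rewrite inE => -[_ /s_inf_finP[hb _]].
  rewrite seatE // indicE; congr ((nat_of_bool _)%:R%:E).
  by apply/idP/idP; rewrite inE.
case: hmu => _ ->; last 2 first.
- exact/measurable_EFinP/measurable_indic.
- by move=> eta; rewrite lee_fin.
congr (_ * _)%E.
transitivity (\int[nu]_(eta in Omega_r R) \sum_(0 <= y <oo)
    (\1_([set eta : config | in_first k y eta]) eta : R)%:E)%E.
  apply: eq_integral => eta; rewrite inE => /Omega_rP[_ hb ha h0].
  have [n [e1 hn hno]] := s_inf1 hb ha h0.
  exact: shift_seated e1 h0 hn hno.
have mO := measurable_Omega_r R; have mF y := measurable_in_first k y.
rewrite integral_nneseries //; last first.
  by move=> y; exact/measurable_EFinP/measurable_indic.
have hI y : (\int[nu]_(eta in Omega_r R)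
    (\1_([set eta : config | in_first k y eta]) eta : R)%:E =
  \esum_(a in [set: excursion])
    (((y <= size (body a))%N && run empty (take y (body a)) k)%:R *
      varphi q a)%:E)%E.
  by rewrite integral_indic // -phihat_first; exact: phihat_full.
under eq_eseriesr => y _ do rewrite hI.
rewrite nneseries_esumT; last first.
  by move=> y; apply: esum_ge0 => a _; rewrite lee_fin mulr_ge0 // varphi_ge0.
rewrite esum_swap; last by move=> y a; rewrite lee_fin mulr_ge0 // varphi_ge0.
apply: eq_esum => a _; rewrite -nneseries_esumT; last first.
  by move=> y; rewrite lee_fin mulr_ge0 // varphi_ge0.
rewrite (@nneseries_cst0 _ _ (size (body a))); last first.
  by move=> y hy; rewrite leqNgt hy mul0r.
rewrite sumEFin; congr EFin; rewrite /etot tot_sum natr_sum mulr_suml.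
by apply: eq_big_nat => y /andP[_ hy]; rewrite -ltnS hy.
Qed.

End Density.

Lemma Wbar_qcd (R : realType) (c d : R) (q : nat -> R)
    (phihat phi : probability config R) (k : nat) :
  0 <= c < 1 -> 0 < d < 1 -> (forall k, (0 < k)%N -> q k = qcd c d k) ->
  is_phihat q phihat -> is_phi q phihat phi ->
  Wbar phi k.+1 =
    (1 / 2 - (1 - d) / (1 + d) * mu c d (c ^+ k) k%:R / 2)%:E.
Proof.
move=> hc /andP[d0 d1] hq hphihat hphi.
have hd : 0 <= d < 1 by rewrite (ltW d0).
rewrite (WbarE hphihat hphi) (esum_seat hc hd hq) (esum_len hc hd hq) /=.
by rewrite -EFinM; congr EFin; field; rewrite ?gt_eqF //; lra.
Qed.

Theorem proposition5p23 (R : realType) (c d : R) (q : nat -> R)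
    (hc : 0 <= c < 1) (hd : 0 < d < 1)
    (hq : forall k : nat, (0 < k)%N ->
      q k = c ^+ (k - 1) * d * (1 - c) ^+ 2 / (1 - c ^+ k * d) ^+ 2) :
  Qplus q /\
  forall phihat phi : probability config R,
    is_phihat q phihat -> is_phi q phihat phi ->
    forall k : nat, (0 < k)%N ->
      Wbar phi k =
        (1 / 2 - (1 + c ^+ k * d) / (2 * (1 - c ^+ k * d))
         + c ^+ (k - 1) * d * (1 - c)
             / ((1 - c ^+ (k - 1) * d) * (1 - c ^+ k * d))
           * (k%:R - 1 + (1 + c) * (1 - d) / ((1 - c) * (1 + d))))%:E
      /\
      J_ phi k =
        (k%:R * c ^+ (k - 1) * d * (1 - c) ^+ 2 * (1 + c ^+ k * d)
           / ((1 - c ^+ (k - 1) * d) * (1 - c ^+ k * d) * (1 - c ^+ k.+1 * d))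
         - 2 * c ^+ (k - 1) * d ^+ 2 * (1 - c) * (1 + c) * (1 - c ^+ k)
           / ((1 - c ^+ (k - 1) * d) * (1 - c ^+ k * d) * (1 - c ^+ k.+1 * d)
              * (1 + d)))%:E.
Proof.
have /andP[c0 c1] := hc; have /andP[d0 d1] := hd.
have hd' : 0 <= d < 1 by rewrite (ltW d0).
have hu := unit_weights_qcd hc hd' hq.
split.
  split; first exact: hu.
  (* [q] is prescribed at positive indices only; at 0 the factor [k] makes both sides vanish. *)
  have -> : (fun k => k%:R * q k) = (fun k => k%:R * qcd c d k).
    by apply/funext => -[|k]; rewrite ?mul0r // hq.
  exact: qcd_summable.
move=> phihat phi hphihat hphi [//|k] _.
have hW j := Wbar_qcd j hc hd hq hphihat hphi.
rewrite /J_ !hW -EFinB !subn1 /=.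
have x1 := exprd_lt1 k hc hd'; have cx1 := exprd_lt1 k.+1 hc hd'.
have ccx1 := exprd_lt1 k.+2 hc hd'; rewrite !(exprS c) in cx1 ccx1 *.
move: x1 cx1 ccx1; rewrite -![k.+1%:R]natr1; set x := c ^+ k => x1 cx1 ccx1.
by split; congr EFin; rewrite /mu; field; rewrite ?gt_eqF //=; lra.
Qed.
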